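(* Let $U\subset\mathbb{R}^2$ be a domain, $f:U\to\mathbb{R}^3$ a frontal, $p\in U$ a cuspidal cross cap, and $\gamma(t)$ $(|t|<\varepsilon)$, with $\varepsilon>0$ sufficiently small, a singular curve consisting of non-degenerate singular points with $\gamma(0)=p$. Then the Gaussian curvature $K$ of $f$ is bounded on a sufficiently small neighborhood of $J:=\gamma\bigl((-\varepsilon,\varepsilon)\bigr)$ if and only if the second fundamental form of $f$ vanishes on $J$. Moreover, if the Gaussian curvature $K$ is non-negative on $U\setminus J$ for a neighborhood $U$ of $p$, then the singular curvature is non-positive.
   Context: Frontal: a $C^\infty$-map $f:U\to\mathbb{R}^3$ with a smooth unit vector field $\nu$ along $f$ (unit normal) perpendicular to $f_*(TU)$. The second fundamental form is $-\langle df,d\nu\rangle$, a smooth symmetric tensor on all of $U$. The Gaussian curvature $K$ is that of $f$ at its regular points (so ''bounded on a neighborhood of $J$'' refers to the regular points in the neighborhood). Signed area density: $\lambda=\det(f_u,f_v,\nu)$, whose zeros are the singular points ($\mathrm{rank}\,df<2$). A singular point is non-degenerate if $d\lambda\ne0$ there. Near a non-degenerate singular point the singular set is a regular curve, parametrized by a regular curve $\gamma$, the singular curve, and $\mathrm{Ker}\,df$ is one-dimensional along it; a null vector field along $\gamma$ is a smooth nowhere-vanishing $\eta(t)\in\mathrm{Ker}\,df_{\gamma(t)}$. A point $p$ is a cuspidal cross cap if there are local diffeomorphisms $\varphi$ of $\mathbb{R}^2$ with $\varphi(p)=0$ and $\Phi$ of $\mathbb{R}^3$ with $\Phi(f(p))=0$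 such that $\Phi\circ f\circ\varphi^{-1}=(u,v^2,uv^3)$ near the origin. Singular curvature: along the singular curve $\gamma$ near a cuspidal edge or a cuspidal cross cap ($\eta$ is there transversal to $\gamma'$, so $(f\circ\gamma)'\neq0$), choose $\eta$ so that $(\gamma',\eta)$ is positively oriented with respect to $(u,v)$, and set, with $\hat\gamma=f\circ\gamma$, $$\kappa_s(t)=\mathrm{sgn}\bigl(d\lambda(\eta(t))\bigr)\,\frac{\det\bigl(\hat\gamma'(t),\hat\gamma''(t),\nu(\gamma(t))\bigr)}{|\hat\gamma'(t)|^3}.$$ *)

(* Defs.v *)
From HB Require Import structures.
From mathcomp Require Import all_boot all_order all_algebra.
From mathcomp Require Import all_classical all_reals all_analysis.

Set Implicit Arguments.
Unset Strict Implicit.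
Unset Printing Implicit Defensive.

Import Order.TTheory GRing.Theory Num.Theory.
Import numFieldNormedType.Exports.

Local Open Scope classical_set_scope.
Local Open Scope ring_scope.

(* C^n on an open set A: f is n times Frechet differentiable there, all its
   iterated directional derivatives up to order n being continuous. *)
Fixpoint Cn_on {R : realType} {V W : normedModType R} (n : nat) (A : set V)
    (f : V -> W) : Prop :=
  if n is m.+1 then
    (forall x, A x -> differentiable f x) /\
    (forall v : V, Cn_on m A (fun x => 'D_v f x))
  else forall x, A x -> {for x, continuous f}.

Definition smooth_on {R : realType} {V W : normedModType R} (A : set V)
    (f : V -> W) : Prop := forall n, Cn_on n A f.

Definition diffeo {R : realType} {V : normedModType R} (A B : set V)
    (h g : V -> V) : Prop :=
  [/\ open A, open B, smooth_on A h & smooth_on B g] /\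
  [/\ forall x, A x -> B (h x), forall y, B y -> A (g y),
      forall x, A x -> g (h x) = x & forall y, B y -> h (g y) = y].

(* The library norm `|v| of a row vector is the sup norm, hence the explicit
   Euclidean structure. *)
Definition dot {R : realType} {n : nat} (v w : 'rV[R]_n) : R :=
  \sum_(i < n) v 0 i * w 0 i.

Definition enorm {R : realType} {n : nat} (v : 'rV[R]_n) : R :=
  Num.sqrt (dot v v).

Definition det2 {R : realType} (a b : 'rV[R]_2) : R :=
  \det (\matrix_(i < 2) [:: a; b]`_i).

Definition det3 {R : realType} (a b c : 'rV[R]_3) : R :=
  \det (\matrix_(i < 3) [:: a; b; c]`_i).

Definition basis_vec {R : realType} (i : 'I_2) : 'rV[R]_2 := delta_mx 0 i.

(* f is a frontal on U with unit normal nu. *)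
Definition frontal {R : realType} (U : set 'rV[R]_2)
    (f nu : 'rV[R]_2 -> 'rV[R]_3) : Prop :=
  [/\ smooth_on U f, smooth_on U nu,
      forall q, U q -> enorm (nu q) = 1 &
      forall q w, U q -> dot ('d f q w) (nu q) = 0].

Definition first_form {R : realType} (f : 'rV[R]_2 -> 'rV[R]_3)
    (q v w : 'rV[R]_2) : R := dot ('d f q v) ('d f q w).

Definition second_form {R : realType} (f nu : 'rV[R]_2 -> 'rV[R]_3)
    (q v w : 'rV[R]_2) : R := - dot ('d f q v) ('d nu q w).

(* Only meaningful at regular points, where the denominator is nonzero. *)
Definition gaussian_curvature {R : realType} (f nu : 'rV[R]_2 -> 'rV[R]_3)
    (q : 'rV[R]_2) : R :=
  \det (\matrix_(i < 2, j < 2) second_form f nu q (basis_vec i) (basis_vec j)) /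
  \det (\matrix_(i < 2, j < 2) first_form f q (basis_vec i) (basis_vec j)).

Definition area_density {R : realType} (f nu : 'rV[R]_2 -> 'rV[R]_3)
    (q : 'rV[R]_2) : R :=
  det3 ('d f q (basis_vec 0)) ('d f q (basis_vec 1)) (nu q).

Definition singular_point {R : realType} (f : 'rV[R]_2 -> 'rV[R]_3)
    (q : 'rV[R]_2) : Prop := (\rank ('J f q) < 2)%N.

Definition regular_point {R : realType} (f : 'rV[R]_2 -> 'rV[R]_3)
    (q : 'rV[R]_2) : Prop := ~ singular_point f q.

Definition nondegenerate_singular_point {R : realType}
    (f nu : 'rV[R]_2 -> 'rV[R]_3) (q : 'rV[R]_2) : Prop :=
  singular_point f q /\ exists w, 'd (area_density f nu) q w != 0.

Definition standard_cuspidal_cross_cap {R : realType} (y : 'rV[R]_2) :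
    'rV[R]_3 :=
  let u := y 0 0 in let v := y 0 1 in
  \row_(i < 3) [:: u; v ^+ 2; u * v ^+ 3]`_i.

(* psi plays the role of phi^-1 and Psi that of Phi^-1. *)
Definition cuspidal_cross_cap {R : realType} (f : 'rV[R]_2 -> 'rV[R]_3)
    (p : 'rV[R]_2) : Prop :=
  exists (A B : set 'rV[R]_2) (phi psi : 'rV[R]_2 -> 'rV[R]_2)
         (C D : set 'rV[R]_3) (Phi Psi : 'rV[R]_3 -> 'rV[R]_3),
    [/\ diffeo A B phi psi, A p & phi p = 0] /\
    [/\ diffeo C D Phi Psi, C (f p), Phi (f p) = 0 &
        \forall y \near (0 : 'rV[R]_2),
          Phi (f (psi y)) = standard_cuspidal_cross_cap y].

Definition singular_curve {R : realType} (U : set 'rV[R]_2)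
    (f nu : 'rV[R]_2 -> 'rV[R]_3) (gamma : R -> 'rV[R]_2) (eps : R) : Prop :=
  smooth_on `]-eps, eps[ gamma /\
  forall t, `]-eps, eps[%classic t ->
    [/\ U (gamma t), derive1 gamma t != 0 &
        nondegenerate_singular_point f nu (gamma t)].

(* A null vector field xi (the eta of kappa_s) along gamma for which (gamma', xi) is positively
   oriented. *)
Definition positive_null_field {R : realType} (f : 'rV[R]_2 -> 'rV[R]_3)
    (gamma xi : R -> 'rV[R]_2) (eps : R) : Prop :=
  smooth_on `]-eps, eps[ xi /\
  forall t, `]-eps, eps[%classic t ->
    [/\ xi t != 0, 'd f (gamma t) (xi t) = 0 &
        0 < det2 (derive1 gamma t) (xi t)].

Definition singular_curvature {R : realType} (f nu : 'rV[R]_2 -> 'rV[R]_3)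
    (gamma xi : R -> 'rV[R]_2) (t : R) : R :=
  let hgamma := f \o gamma in
  Num.sg ('d (area_density f nu) (gamma t) (xi t)) *
  (det3 (derive1 hgamma t) (derive1 (derive1 hgamma) t) (nu (gamma t)) /
   enorm (derive1 hgamma t) ^+ 3).

Definition curvature_bounded_on {R : realType} (f nu : 'rV[R]_2 -> 'rV[R]_3)
    (V : set 'rV[R]_2) : Prop :=
  exists M : R, forall q, V q -> regular_point f q ->
    `|gaussian_curvature f nu q| <= M.

Definition second_form_vanishes_on {R : realType}
    (f nu : 'rV[R]_2 -> 'rV[R]_3) (J : set 'rV[R]_2) : Prop :=
  forall q, J q -> forall v w, second_form f nu q v w = 0.

(* Main.v *)
Require Import Defs.
From HB Require Import structures.
From mathcomp Require Import all_boot all_order all_algebra.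
From mathcomp Require Import all_classical all_reals all_analysis.
From mathcomp Require Import ring lra.
Import Order.TTheory GRing.Theory Num.Theory.
Import numFieldNormedType.Exports.
Local Open Scope classical_set_scope.
Local Open Scope ring_scope.

(** The normal form (u, v) |-> (u, v^2, u v^3) of the cuspidal cross cap gives
    coordinates (u, v) near p and a smooth field h along the surface g, read in
    these coordinates, with g_v = v h and with g_u, h and the unit normal n
    linearly independent.  Hence the singular set is the axis v = 0, and the null
    direction there is d/dv.  Put
      L = <g_uu, n>,  M = <h_u, n>,  N = <h_v, n>,  T = det(g_u, h, n).
    The coefficients of the second fundamental form are L, v M and v N, and the
    determinant of the first one is v^2 T^2; therefore, off the axis,
      L N = v (K T^2 + M^2).                                              (1)
    What distinguishes the cuspidal cross cap is that N, on the axis, vanishes at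
    the origin only ([exists_adapted_chart]).

    On the axis only L survives in the second fundamental form
    ([second_form_eq0]).  If K is bounded, (1) forces L N = 0 on the axis, hence
    L = 0 away from the origin, and at the origin by continuity
    ([flat_of_bounded]).  Conversely, if L = 0 on the axis, then L / v stays
    bounded by the mean value theorem, and so does K = ((L / v) N - M^2) / T^2
    ([bounded_of_flat]).

    If K >= 0, then by (1) the product L N has the sign of v, so again L = 0 on
    the axis; dividing (1) by v and letting v tend to 0 gives L_v N >= M^2 >= 0.
    On the axis L_v = <g_uu, n_v> because g_uuv = v h_uu, and N = - <h, n_v>, so
    <g_uu, n_v> <h, n_v> <= 0.  There n_v is orthogonal to g_u and to n, so these
    two scalar products are, up to one common factor, det(g_u, g_uu, n) and
    T = det(g_u, h, n): the product of the two determinants is nonpositive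
    ([sign_of_nonneg]).  It has the sign of the singular curvature, because T has
    the sign of the derivative of the area density along d/dv, and the remaining
    factors combine into squares and into the positive det(gamma', xi)
    ([singular_curvature_le0]). *)

(** * Differential calculus of C^n maps *)

Section SmoothCalculus.
Set Implicit Arguments.
Unset Strict Implicit.
Context {R : realType}.
Implicit Types V W : normedModType R.

(** Makes differentiability a local property, as needed to replace a map by another
    one that agrees with it on an open set only. *)
Lemma near_eq_differentiable {V W} (f g : V -> W) (x : V) :
  {near x, f =1 g} -> differentiable f x -> differentiable g x.
Proof.
move=> fg df.
have gd : g \o shift x = cst (g x) + 'd f x +o_ 0 id.
  apply/eqaddoP => e e0.
  have /eqaddoP /(_ e e0) := diff_locally df.
  have near0 : \forall h \near 0, f (h + x) = g (h + x).
    by have := fg; rewrite [X in X -> _](near_shift 0)/=; apply: filterS => h;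
       rewrite /= subr0.
  apply: filter_app; near=> h.
  have fgx : f x = g x := nbhs_singleton fg.
  have fgh : f (h + x) = g (h + x) by near: h.
  by rewrite /= !fctE /= fgx fgh.
have cd : continuous ('d f x) by apply: diff_continuous.
have dE := diff_unique cd gd.
apply: (diff_locallyP x g).2; split; first by rewrite dE.
by rewrite dE.
Unshelve. all: by end_near. Qed.

Lemma differentiable_rowP {V} {k} (f : V -> 'rV[R]_k) (x : V) :
  differentiable f x <-> forall i, differentiable (fun y => f y 0 i : R) x.
Proof.
split=> [df i|df].
  exact: (differentiable_comp df (differentiable_coord _ _ _)).
have -> : f = \sum_(i < k) (fun y => (f y 0 i : R) *: ('e_i : 'rV[R]_k)).
  by apply/funext => y; rewrite fct_sumE -row_sum_delta.
apply: differentiable_sum => i.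
exact: (@differentiableZl _ _ _ (fun y => f y 0 i) 'e_i x (df i)).
Qed.

Lemma derive_row {V} {k} (f : V -> 'rV[R]_k) (x v : V) i :
  differentiable f x -> ('D_v f x) 0 i = 'D_v (fun y => f y 0 i : R) x.
Proof.
by move=> df; rewrite derive_mx ?mxE//; exact: diff_derivable.
Qed.

Lemma Cn_on_ext {V W} n (A : set V) (f g : V -> W) :
  open A -> (forall x, A x -> f x = g x) -> Cn_on n A f -> Cn_on n A g.
Proof.
move=> Ao; elim: n f g => [|n IH] f g fg /=.
  move=> cf x Ax; change (g @ x --> g x); rewrite -fg//.
  apply: cvg_trans (cf _ Ax); apply: near_eq_cvg.
  near=> y; apply: fg; near: y; exact: open_nbhs_nbhs.
have fgn x : A x -> {near x, f =1 g}.
  move=> Ax; near=> y; apply: fg; near: y; exact: open_nbhs_nbhs.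
move=> [df Df]; split=> [x Ax|v].
  exact: near_eq_differentiable (fgn _ Ax) (df _ Ax).
apply: IH (Df v) => x Ax; exact: near_eq_derive (fgn _ Ax).
Unshelve. all: by end_near. Qed.

Lemma Cn_on_sub {V W} n (A B : set V) (f : V -> W) :
  A `<=` B -> Cn_on n B f -> Cn_on n A f.
Proof.
move=> AB; elim: n f => [|n IH] f /= => [cf x /AB/cf//|[df Df]].
by split=> [x /AB/df//|v]; apply: IH.
Qed.

Lemma Cn_onW {V W} n (A : set V) (f : V -> W) : Cn_on n.+1 A f -> Cn_on n A f.
Proof.
elim: n f => [|n IH] f [df Df] => [x Ax|].
  exact/differentiable_continuous/df.
by split=> // v; apply: IH.
Qed.

Lemma Cn_on_cst {V W} n (A : set V) (c : W) : Cn_on n A (fun=> c : W).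
Proof.
elim: n c => [|n IH] c /=; first by move=> x _; exact: cvg_cst.
split=> [x _|v]; first exact: differentiable_cst.
rewrite [X in Cn_on _ _ X](_ : _ = fun=> 0); first exact: IH.
by apply/funext => x; exact: derive_cst.
Qed.

Lemma Cn_onD {V W} n (A : set V) (f g : V -> W) : open A ->
  Cn_on n A f -> Cn_on n A g -> Cn_on n A (fun x => f x + g x).
Proof.
move=> Ao; elim: n f g => [|n IH] f g /=.
  by move=> cf cg x Ax; apply: cvgD; [exact: cf|exact: cg].
move=> [df Df] [dg Dg]; split=> [x Ax|v].
  exact: (differentiableD (df _ Ax) (dg _ Ax)).
apply: (@Cn_on_ext _ _ _ _ (fun x => 'D_v f x + 'D_v g x)) => //.
  by move=> x Ax; rewrite -(deriveD (diff_derivable (df _ Ax)) (diff_derivable (dg _ Ax))).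
exact: IH.
Qed.

Lemma Cn_onM {V} n (A : set V) (f g : V -> R) : open A ->
  Cn_on n A f -> Cn_on n A g -> Cn_on n A (fun x => f x * g x).
Proof.
move=> Ao; elim: n f g => [|n IH] f g.
  by move=> cf cg x Ax; apply: cvgM; [exact: cf|exact: cg].
move=> Cf Cg; have [df Df] := Cf; have [dg Dg] := Cg; split=> [x Ax|v].
  exact: (differentiableM (df _ Ax) (dg _ Ax)).
apply: (@Cn_on_ext _ _ _ _ (fun x => f x * 'D_v g x + g x * 'D_v f x)) => //.
  by move=> x Ax; rewrite -(deriveM (diff_derivable (df _ Ax)) (diff_derivable (dg _ Ax))).
by apply: Cn_onD => //; [exact: IH (Cn_onW Cf) (Dg v)|exact: IH (Cn_onW Cg) (Df v)].
Qed.

Lemma Cn_on_sum {V W} n (A : set V) k (f : 'I_k -> V -> W) : open A ->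
  (forall i, Cn_on n A (f i)) -> Cn_on n A (fun x => \sum_(i < k) f i x).
Proof.
move=> Ao; elim: k f => [|k IH] f Cf.
  rewrite [X in Cn_on _ _ X](_ : _ = fun=> 0); first exact: Cn_on_cst.
  by apply/funext => x; rewrite big_ord0.
rewrite [X in Cn_on _ _ X](_ : _ =
    fun x => \sum_(i < k) f (widen_ord (leqnSn k) i) x + f ord_max x); last first.
  by apply/funext => x; rewrite big_ord_recr.
by apply: Cn_onD => //; apply: IH.
Qed.

Lemma Cn_on_rowP {V} {k} n (A : set V) (f : V -> 'rV[R]_k) : open A ->
  Cn_on n A f <-> forall i, Cn_on n A (fun y => f y 0 i : R).
Proof.
move=> Ao; elim: n f => [|n IH] f /=.
  split=> [cf i x Ax|cf].
    exact: (continuous_comp (cf _ Ax) (@coord_continuous _ _ _ _ _ _)).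
  rewrite (_ : f = fun x => \sum_(i < k) f x 0 i *: 'e_i); last first.
    by apply/funext => x; rewrite -row_sum_delta.
  apply: (@Cn_on_sum _ _ 0%N A k (fun i x => f x 0 i *: 'e_i)) => // i x Ax.
  exact: cvgZr_tmp (cf i x Ax).
split=> [[df Df] i|Cf].
  split=> [x Ax|v]; first by apply/differentiable_rowP: i; exact: df.
  apply: (@Cn_on_ext _ _ _ _ (fun x => ('D_v f x) 0 i)) => //.
    by move=> x Ax; exact/derive_row/df.
  exact: (IH _).1.
have df x : A x -> differentiable f x.
  by move=> Ax; apply/differentiable_rowP => i; exact: (Cf i).1.
split=> // v; apply: (IH _).2 => i.
apply: (@Cn_on_ext _ _ _ _ (fun x => 'D_v (fun y => f y 0 i : R) x)) => //.
  by move=> x Ax; exact/esym/derive_row/df.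
exact: (Cf i).2.
Qed.

(** The chain rule with the outer differential expanded on the standard basis; it
    expresses the derivative of a composite by sums, products and composites of maps
    of one order less, whence [Cn_on_comp] by induction. *)
Lemma derive_comp_row {V W} {k} (F : 'rV[R]_k -> W) (G : V -> 'rV[R]_k) (x v : V) :
  differentiable G x -> differentiable F (G x) ->
  'D_v (F \o G) x = \sum_(i < k) ('D_v G x) 0 i *: 'D_('e_i) F (G x).
Proof.
move=> dG dF.
rewrite deriveE; last exact: differentiable_comp.
rewrite diff_comp//= -(deriveE v dG) [in LHS](row_sum_delta ('D_v G x)) linear_sum/=.
by apply: eq_bigr => i _; rewrite linearZ/= -deriveE.
Qed.

Lemma Cn_on_comp {V} {k} {l} n (A : set 'rV[R]_k) (B : set V)
    (F : 'rV[R]_k -> 'rV[R]_l) (G : V -> 'rV[R]_k) :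
  open B -> (forall x, B x -> A (G x)) ->
  Cn_on n A F -> Cn_on n B G -> Cn_on n B (F \o G).
Proof.
move=> Bo BA; elim: n F => [|n IH] F.
  by move=> cF cG x Bx; apply: continuous_comp; [exact: cG|exact/cF/BA].
move=> [dF DF] CG; have [dG DG] := CG.
split=> [x Bx|v]; first by apply: differentiable_comp; [exact: dG|exact/dF/BA].
apply: (@Cn_on_ext _ _ _ _
    (fun x => \sum_(i < k) ('D_v G x) 0 i *: 'D_('e_i) F (G x))) => //.
  by move=> x Bx; rewrite derive_comp_row//; [exact: dG|exact/dF/BA].
apply: Cn_on_sum => // i; apply/Cn_on_rowP => // j.
rewrite [X in Cn_on _ _ X](_ : _ =
    fun y => ('D_v G y) 0 i * ('D_('e_i) F (G y)) 0 j); last first.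
  by apply/funext => y; rewrite !mxE.
have DGi : Cn_on n B (fun y => 'D_v G y 0 i) by apply: (Cn_on_rowP _ _ Bo).1; exact: DG.
have DFi : Cn_on n B ('D_('e_i) F \o G) := IH _ (DF _) (Cn_onW CG).
by apply: Cn_onM => //; exact: (Cn_on_rowP _ _ Bo).1 DFi j.
Qed.

Lemma cvg_difference_quotient {V W} (F : V -> W) (y v : V) : derivable F y v ->
  h^-1 *: (F (y + h *: v) - F y) @[h --> (0 : R)^'] --> 'D_v F y.
Proof. by move=> dF; under eq_fun do rewrite [y + _]addrC; exact: dF. Qed.

End SmoothCalculus.

(** * Symmetry of second derivatives *)

Section Schwarz.
Set Implicit Arguments.
Unset Strict Implicit.
Context {R : realType} {V : normedModType R}.
Implicit Types (F G : V -> R) (A : set V).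

Lemma is_derive_line G (z u : V) (s : R) :
  differentiable G (z + s *: u) ->
  is_derive s 1 (fun t : R => G (z + t *: u)) ('D_u G (z + s *: u)).
Proof.
move=> dG; have [d1 d2] : is_derive (z + s *: u) u G ('D_u G (z + s *: u)).
  exact/derivableP/diff_derivable.
have E : (fun h : R => h^-1 *: (((fun t : R => G (z + t *: u)) \o shift s) (h *: 1) -
     G (z + s *: u))) =
  (fun h : R => h^-1 *: ((G \o shift (z + s *: u)) (h *: u) - G (z + s *: u))).
  apply/funext => h /=; congr (_ *: (G _ - _)).
  by rewrite [h *: 1]mulr1 scalerDl addrCA.
by split; [rewrite /derivable E|rewrite /derive E].
Qed.

Lemma MVT_line G (z u : V) :
  (forall s : R, 0 <= s <= 1 -> differentiable G (z + s *: u)) ->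
  exists2 s : R, 0 <= s <= 1 & G (z + u) - G z = 'D_u G (z + s *: u).
Proof.
move=> dG.
have dl (s : R) : 0 <= s <= 1 ->
    is_derive s 1 (fun t : R => G (z + t *: u)) ('D_u G (z + s *: u)).
  by move=> /dG; exact: is_derive_line.
have [s||s] := @MVT_segment R (fun t => G (z + t *: u))
    (fun t => 'D_u G (z + t *: u)) 0 1 ler01.
- by rewrite in_itv/= => /andP[s0 s1]; apply: dl; rewrite !ltW.
- by apply: derivable_within_continuous => s; rewrite in_itv/= => /dl[].
rewrite in_itv/= => s01; rewrite scale1r scale0r addr0 subr0 mulr1 => E.
by exists s.
Qed.

Lemma derive_translate F (w v y : V) :
  'D_v (fun z => F (z + w)) y = 'D_v F (y + w).
Proof.
rewrite /derive (_ : (fun h : R => h^-1 *: (((fun z => F (z + w)) \o shift y) (h *: v)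
  - F (y + w))) = (fun h => h^-1 *: ((F \o shift (y + w)) (h *: v) - F (y + w))))//.
by apply/funext => h /=; rewrite addrA.
Qed.

Lemma differentiable_translate F (w y : V) :
  differentiable F (y + w) -> differentiable (fun z => F (z + w)) y.
Proof. by move=> dF; apply: (@differentiable_comp _ _ _ _ (fun z => z + w) F). Qed.

(** The mean value theorem in direction v for the increment of F along w, followed
    by the mean value theorem in direction w for 'D_v F.  The left-hand side is
    symmetric in v and w, the right-hand side is not: this gives [schwarz]. *)
Lemma second_difference F A (x v w : V) : Cn_on 2 A F ->
  (forall s t : R, 0 <= s <= 1 -> 0 <= t <= 1 -> A (x + s *: v + t *: w)) ->
  exists s t : R, [/\ 0 <= s <= 1, 0 <= t <= 1 &
    F (x + v + w) - F (x + v) - (F (x + w) - F x) =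
    'D_w ('D_v F) (x + s *: v + t *: w)].
Proof.
move=> [dF DF] Axst.
pose G y := F (y + w) - F y.
have dFs (s t : R) : 0 <= s <= 1 -> 0 <= t <= 1 -> differentiable F (x + s *: v + t *: w).
  by move=> s01 t01; apply/dF/Axst.
have dF0 (s : R) : 0 <= s <= 1 -> differentiable F (x + s *: v).
  by move=> s01; have := dFs s 0 s01; rewrite scale0r addr0; apply; rewrite lexx ler01.
have dF1 (s : R) : 0 <= s <= 1 -> differentiable F (x + s *: v + w).
  by move=> s01; have := dFs s 1 s01; rewrite scale1r; apply; rewrite lexx ler01.
have [s s01 Es] : exists2 s : R, 0 <= s <= 1 & G (x + v) - G x = 'D_v G (x + s *: v).
  apply: MVT_line => s s01; apply: (@differentiableB _ _ _ (fun y => F (y + w)) F).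
    exact/differentiable_translate/dF1.
  exact: dF0.
have [t t01 Et] : exists2 t : R, 0 <= t <= 1 &
   'D_v F (x + s *: v + w) - 'D_v F (x + s *: v) = 'D_w ('D_v F) (x + s *: v + t *: w).
  have [dDF _] := DF v.
  exact: MVT_line (fun t t01 => dDF _ (Axst s t s01 t01)).
exists s, t; split => //; rewrite -Et -[LHS]/(G (x + v) - G x) Es.
rewrite (_ : G = (fun y => F (y + w)) - F)// deriveB ?derive_translate//.
  exact/diff_derivable/differentiable_translate/dF1.
exact/diff_derivable/dF0.
Qed.

Lemma derive_scale {W : normedModType R} (G : V -> W) (c : R) (v y : V) :
  differentiable G y -> 'D_(c *: v) G y = c *: 'D_v G y.
Proof. by move=> dG; rewrite !deriveE// linearZ. Qed.

Lemma derive2_scale F A (c : R) (v w y : V) : open A -> A y -> Cn_on 2 A F ->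
  'D_(c *: w) ('D_(c *: v) F) y = c * c * 'D_w ('D_v F) y.
Proof.
move=> Ao Ay [dF DF]; have [dDv _] := DF v.
rewrite (@near_eq_derive _ _ _ _ (fun z => c *: 'D_v F z)).
  rewrite derive_scale; last by apply: (differentiableZ c); exact: dDv.
  by rewrite (deriveZ c); [rewrite -mulrA|exact/diff_derivable/dDv].
near=> z; apply: derive_scale; apply: dF; near: z; exact: open_nbhs_nbhs.
Unshelve. all: by end_near. Qed.

Lemma schwarz F A (x v w : V) : open A -> A x -> Cn_on 2 A F ->
  'D_v ('D_w F) x = 'D_w ('D_v F) x.
Proof.
move=> Ao Ax CF.
have cancel_diff (a b c d k r r' : R) : k != 0 ->
    a - b - (c - d) = k * r -> a - c - (b - d) = k * r' -> r = r'.
  by move=> k0 E1 E2; apply: (mulfI k0); rewrite -E1 -E2; ring.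
have close_both (a b c e : R) : `|a - c| < e / 2 -> `|b - c| < e / 2 ->
    `|a - b| <= e.
  rewrite !ltr_norml ler_norml => /andP[? ?] /andP[? ?].
  by apply/andP; split; lra.
apply/eqP; rewrite -subr_eq0 -normr_le0; apply/ler_addgt0Pl => e e0; rewrite addr0.
have ccont u u' : {for x, continuous ('D_u ('D_u' F))}.
  by case: CF => _ /(_ u') [_ /(_ u)]; apply.
have close (P Q : V -> R) : {for x, continuous P} -> {for x, continuous Q} ->
    exists2 d : R, 0 < d & forall y, ball x d y ->
      [/\ A y, `|P x - P y| < e / 2 & `|Q x - Q y| < e / 2].
  move=> cP cQ; have e20 : 0 < e / 2 by rewrite divr_gt0.
  have /cvgrPdist_lt /(_ _ e20) c1 := cP.
  have /cvgrPdist_lt /(_ _ e20) c2 := cQ.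
  have c3 : \forall y \near x, A y by exact: open_nbhs_nbhs.
  have : \forall y \near x, [/\ A y, `|P x - P y| < e / 2 & `|Q x - Q y| < e / 2].
    exact: filterS3 c3 c1 c2.
  by move=> /nbhs_ballP[d /= d0 Hd]; exists d.
(* A parallelogram with sides h v and h w on which both second derivatives are
   within e / 2 of their values at x. *)
have [d d0 Hd] := close _ _ (ccont v w) (ccont w v).
have D0 : 0 < `|v| + `|w| + 1 by rewrite ltr_wpDl// addr_ge0.
have [h h0 hD] : exists2 h : R, 0 < h & h * (2 * (`|v| + `|w| + 1)) = d.
  exists (d / (2 * (`|v| + `|w| + 1))); first by rewrite divr_gt0// mulr_gt0.
  by rewrite divfK// gt_eqF// mulr_gt0.
have Hst (s t : R) : 0 <= s <= 1 -> 0 <= t <= 1 ->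
    ball x d (x + s *: (h *: v) + t *: (h *: w)).
  move=> /andP[s0 s1] /andP[t0 t1]; rewrite -ball_normE/= -addrA opprD addNKr normrN.
  rewrite (le_lt_trans (ler_normD _ _))// !normrZ.
  rewrite (ger0_norm s0) (ger0_norm t0) (gtr0_norm h0).
  have v0 : 0 <= h * `|v| by rewrite mulr_ge0// ltW.
  have w0 : 0 <= h * `|w| by rewrite mulr_ge0// ltW.
  have : s * (h * `|v|) <= h * `|v| by rewrite ler_piMl.
  have : t * (h * `|w|) <= h * `|w| by rewrite ler_piMl.
  lra.
have [s [t [s01 t01 E1]]] : exists s t : R, [/\ 0 <= s <= 1, 0 <= t <= 1 &
    F (x + h *: v + h *: w) - F (x + h *: v) - (F (x + h *: w) - F x) =
    'D_(h *: w) ('D_(h *: v) F) (x + s *: (h *: v) + t *: (h *: w))].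
  by apply: (second_difference CF) => s t s01 t01; case: (Hd _ (Hst s t s01 t01)).
have [t' [s' [t01' s01' E2]]] : exists t s : R, [/\ 0 <= t <= 1, 0 <= s <= 1 &
    F (x + h *: w + h *: v) - F (x + h *: w) - (F (x + h *: v) - F x) =
    'D_(h *: v) ('D_(h *: w) F) (x + t *: (h *: w) + s *: (h *: v))].
  apply: (second_difference CF) => t' s' t01' s01'; rewrite addrAC.
  by case: (Hd _ (Hst s' t' s01' t01')).
have [Az z1 z2] := Hd _ (Hst s t s01 t01).
have [Az' z1' z2'] := Hd _ (Hst s' t' s01' t01').
rewrite (derive2_scale _ _ _ Ao Az CF) in E1.
rewrite [x + t' *: _ + _]addrAC (derive2_scale _ _ _ Ao Az' CF) in E2.
have E : 'D_w ('D_v F) (x + s *: (h *: v) + t *: (h *: w)) =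
         'D_v ('D_w F) (x + s' *: (h *: v) + t' *: (h *: w)).
  rewrite [x + h *: w + _]addrAC in E2.
  by apply: cancel_diff E1 E2; rewrite mulf_neq0// gt_eqF.
rewrite E in z2; exact: close_both z1' z2.
Qed.

End Schwarz.

(** * Determinants and scalar products in dimensions 2 and 3 *)

Section VectorAlgebra.
Set Implicit Arguments.
Unset Strict Implicit.
Context {R : realType}.
Implicit Types (a b c x : 'rV[R]_3).

Lemma ord3E : (lift ord0 (ord0 : 'I_2) = 1 :> 'I_3) *
  (lift ord0 (lift ord0 (ord0 : 'I_1)) = 2 :> 'I_3) *
  (lift (lift ord0 (ord0 : 'I_2)) (ord0 : 'I_2) = 0 :> 'I_3).
Proof. by split; [split|]; apply/val_inj. Qed.

Lemma dot3E a b : dot a b = a 0 0 * b 0 0 + a 0 1 * b 0 1 + a 0 2 * b 0 2.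
Proof.
by rewrite /dot !big_ord_recl big_ord0 addr0 addrA !ord3E.
Qed.

Lemma det_mx22 (M : 'M[R]_2) : \det M = M 0 0 * M 1 1 - M 0 1 * M 1 0.
Proof.
rewrite (expand_det_row _ 0) !big_ord_recl big_ord0 /cofactor !det_mx11 !mxE/=.
have e1 : lift 0 0 = 1 :> 'I_2 by apply/val_inj.
have e2 : lift 1 0 = 0 :> 'I_2 by apply/val_inj.
by rewrite !(e1, e2) addn0 expr0 expr1 mul1r addr0 mulN1r mulrN.
Qed.

Lemma det2E (v w : 'rV[R]_2) : det2 v w = v 0 0 * w 0 1 - v 0 1 * w 0 0.
Proof. by rewrite /det2 det_mx22 !mxE. Qed.

Lemma det3E a b c : det3 a b c =
  a 0 0 * (b 0 1 * c 0 2 - b 0 2 * c 0 1) -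
  a 0 1 * (b 0 0 * c 0 2 - b 0 2 * c 0 0) +
  a 0 2 * (b 0 0 * c 0 1 - b 0 1 * c 0 0).
Proof.
rewrite /det3 (expand_det_row _ 0) !big_ord_recl big_ord0 /cofactor !det_mx22 !mxE/=.
have i1 : lift ord0 0 = 1 :> 'I_3 by apply/val_inj.
have i2 : lift ord0 1 = 2 :> 'I_3 by apply/val_inj.
have i3 : lift (1 : 'I_3) 0 = 0 by apply/val_inj.
have i4 : lift (1 : 'I_3) 1 = 2 by apply/val_inj.
have i5 : lift (2 : 'I_3) 0 = 0 by apply/val_inj.
have i6 : lift (2 : 'I_3) 1 = 1 by apply/val_inj.
rewrite !(i1, i2, ord3E) !(i3, i4, i5, i6) /bump/= addr0.
rewrite (_ : ord0 = 0 :> 'I_3)// !addn0 expr0 expr1.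
rewrite (_ : (-1) ^+ (0 + (1 + 1)) = 1 :> R); ring.
Qed.

Definition cross a b : 'rV[R]_3 :=
  \row_(i < 3) [:: a 0 1 * b 0 2 - a 0 2 * b 0 1;
                   a 0 2 * b 0 0 - a 0 0 * b 0 2;
                   a 0 0 * b 0 1 - a 0 1 * b 0 0]`_i.

Lemma det3_cross a b c : det3 a b c = dot (cross a b) c.
Proof. by rewrite det3E dot3E !mxE/=; ring. Qed.

Lemma dotC a b : dot a b = dot b a.
Proof. by rewrite !dot3E; ring. Qed.

Lemma dotDl a b c : dot (a + b) c = dot a c + dot b c.
Proof. by rewrite !dot3E !mxE; ring. Qed.

Lemma dotZl (k : R) a b : dot (k *: a) b = k * dot a b.
Proof. by rewrite !dot3E !mxE; ring. Qed.

Lemma dotDr a b c : dot c (a + b) = dot c a + dot c b.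
Proof. by rewrite !dot3E !mxE; ring. Qed.

Lemma dotZr (k : R) a b : dot a (k *: b) = k * dot a b.
Proof. by rewrite !dot3E !mxE; ring. Qed.

Lemma dot0l a : dot 0 a = 0.
Proof. by rewrite dot3E !mxE; ring. Qed.

Lemma dot_ge0 a : 0 <= dot a a.
Proof. by rewrite dot3E -!expr2 !addr_ge0// sqr_ge0. Qed.

Lemma dot_eq0 a : (dot a a == 0) = (a == 0).
Proof.
apply/eqP/eqP => [|->]; last exact: dot0l.
rewrite dot3E -!expr2 => /eqP.
rewrite !paddr_eq0 ?addr_ge0 ?sqr_ge0// !sqrf_eq0 => /andP[/andP[/eqP a0 /eqP a1] /eqP a2].
apply/rowP => i; rewrite mxE.
have [-> | -> | ->] : [\/ i = 0, i = 1 | i = 2] => //.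
by case: i => [[|[|[|//]]]] ?; [apply: Or31|apply: Or32|apply: Or33]; apply/val_inj.
Qed.

(** The product of a matrix with the transpose of another one has the mutual scalar
    products of the rows as entries. *)
Lemma det3_gram a b c a' b' c' : det3 a b c * det3 a' b' c' =
  det3 (\row_(i < 3) [:: dot a a'; dot a b'; dot a c']`_i)
       (\row_(i < 3) [:: dot b a'; dot b b'; dot b c']`_i)
       (\row_(i < 3) [:: dot c a'; dot c b'; dot c c']`_i).
Proof. by rewrite !det3E !mxE/= !dot3E; ring. Qed.

(** Only the last entry of the third row of the Gram matrix is nonzero. *)
Lemma det3_normal_gram a b n x : dot a n = 0 -> dot b n = 0 ->
  det3 a b n * det3 a b x =
  (dot a a * dot b b - dot a b ^+ 2) * dot n x.
Proof.
move=> an bn; rewrite det3_gram det3E !mxE/=.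
rewrite (dotC n a) (dotC n b) an bn (dotC b a); ring.
Qed.

(** Lagrange's identity: the Gram determinant of a and b is the squared length of
    their cross product. *)
Lemma gram_independent a b x : det3 a b x != 0 ->
  dot a a * dot b b - dot a b ^+ 2 != 0.
Proof.
apply: contraNneq => W0; apply/eqP.
have : dot (cross a b) (cross a b) = 0.
  by rewrite -W0 !dot3E !mxE/=; ring.
by move=> /eqP; rewrite dot_eq0 det3_cross => /eqP ->; rewrite dot0l.
Qed.

(** The first and the third row of the Gram matrix vanish off the diagonal. *)
Lemma det3_perp_gram (g a n x : 'rV[R]_3) :
  dot g x = 0 -> dot n x = 0 -> dot g n = 0 -> dot n n = 1 ->
  det3 g a n * det3 g x n = dot g g * dot a x.
Proof.
move=> gx nx gn nn; rewrite det3_gram det3E !mxE/=.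
by rewrite gx gn nx nn (dotC n g) gn; ring.
Qed.

(** By [det3_perp_gram] both determinants are obtained from <a, x> and <b, x> by the
    same nonzero factor. *)
Lemma det3_sign (g a b n x : 'rV[R]_3) :
  dot g x = 0 -> dot n x = 0 -> dot g n = 0 -> dot n n = 1 -> dot a x != 0 ->
  det3 g a n != 0 -> dot b x * dot a x <= 0 -> det3 g a n * det3 g b n <= 0.
Proof.
move=> gx nx gn nn ax T0 ba.
have Ea := det3_perp_gram a gx nx gn nn.
have Eb := det3_perp_gram b gx nx gn nn.
have g0 : dot g g != 0.
  by rewrite dot_eq0; apply: contraNneq T0 => ->; rewrite det3E !mxE; apply/eqP; ring.
have x0 : det3 g x n != 0.
  by apply: contra_neq (mulf_neq0 g0 ax) => x0; rewrite -Ea x0 mulr0.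
have X2 : 0 < det3 g x n ^+ 2 by rewrite exprn_even_gt0.
rewrite -(pmulr_lle0 _ X2).
rewrite (_ : _ * _ * _ ^+ 2 = (det3 g a n * det3 g x n) * (det3 g b n * det3 g x n)).
  rewrite Ea Eb mulrACA [dot a x * _]mulrC.
  by apply: mulr_ge0_le0 => //; exact: sqr_ge0.
by ring.
Qed.

End VectorAlgebra.

Local Opaque derive.

(** * Smooth maps *)

Section SmoothOn.
Set Implicit Arguments.
Unset Strict Implicit.
Context {R : realType}.
Implicit Types V W : normedModType R.

Lemma smooth_on_differentiable {V W} (A : set V) (F : V -> W) x :
  smooth_on A F -> A x -> differentiable F x.
Proof. by move=> /(_ 1%N) [dF _]; exact: dF. Qed.

Lemma smooth_on_derivable {V W} (A : set V) (F : V -> W) x v :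
  smooth_on A F -> A x -> derivable F x v.
Proof. by move=> sF Ax; exact: diff_derivable (smooth_on_differentiable sF Ax). Qed.

Lemma smooth_on_continuous {V W} (A : set V) (F : V -> W) x :
  smooth_on A F -> A x -> {for x, continuous F}.
Proof. by move=> /(_ 0%N); exact. Qed.

Lemma smooth_on_derive {V W} (A : set V) (F : V -> W) v :
  smooth_on A F -> smooth_on A ('D_v F).
Proof. by move=> sF n; have [_] := sF n.+1; exact. Qed.

Lemma smooth_on_sub {V W} (A B : set V) (F : V -> W) :
  A `<=` B -> smooth_on B F -> smooth_on A F.
Proof. by move=> AB sF n; apply: Cn_on_sub AB _. Qed.

Lemma smooth_on_ext {V W} (A : set V) (F G : V -> W) : open A ->
  (forall x, A x -> F x = G x) -> smooth_on A F -> smooth_on A G.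
Proof. by move=> Ao FG sF n; apply: Cn_on_ext FG _. Qed.

Lemma smooth_on_cst {V W} (A : set V) (c : W) : smooth_on A (fun=> c : W).
Proof. by move=> n; exact: Cn_on_cst. Qed.

Lemma smooth_onD {V W} (A : set V) (F G : V -> W) : open A ->
  smooth_on A F -> smooth_on A G -> smooth_on A (fun x => F x + G x).
Proof. by move=> Ao sF sG n; exact: Cn_onD. Qed.

Lemma smooth_onM {V} (A : set V) (F G : V -> R) : open A ->
  smooth_on A F -> smooth_on A G -> smooth_on A (fun x => F x * G x).
Proof. by move=> Ao sF sG n; exact: Cn_onM. Qed.

Lemma smooth_onB {V} (A : set V) (F G : V -> R) : open A ->
  smooth_on A F -> smooth_on A G -> smooth_on A (fun x => F x - G x).
Proof.
move=> Ao sF sG; rewrite [X in smooth_on _ X](_ : _ = fun x => F x + (-1) * G x).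
  by apply: smooth_onD => //; apply: smooth_onM => //; exact: smooth_on_cst.
by apply/funext => x; rewrite mulN1r.
Qed.

Lemma smooth_on_coord {V} {k} (A : set V) (F : V -> 'rV[R]_k) i : open A ->
  smooth_on A F -> smooth_on A (fun x => F x 0 i : R).
Proof. by move=> Ao sF n; exact: (Cn_on_rowP n F Ao).1 (sF n) i. Qed.

Lemma smooth_on_row {V} {k} (A : set V) (F : V -> 'rV[R]_k) : open A ->
  (forall i, smooth_on A (fun x => F x 0 i : R)) -> smooth_on A F.
Proof. by move=> Ao sF n; apply: (Cn_on_rowP n F Ao).2 => i; exact: sF. Qed.

Lemma smooth_onZ {V} {k} (A : set V) (a : V -> R) (F : V -> 'rV[R]_k) : open A ->
  smooth_on A a -> smooth_on A F -> smooth_on A (fun x => a x *: F x).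
Proof.
move=> Ao sa sF; apply: smooth_on_row => // i.
rewrite [X in smooth_on _ X](_ : _ = fun x => a x * F x 0 i).
  by apply: smooth_onM => //; exact: smooth_on_coord.
by apply/funext => x; rewrite mxE.
Qed.

Lemma smooth_on_comp {V} {k l} (A : set 'rV[R]_k) (B : set V)
    (F : 'rV[R]_k -> 'rV[R]_l) (G : V -> 'rV[R]_k) :
  open B -> (forall x, B x -> A (G x)) ->
  smooth_on A F -> smooth_on B G -> smooth_on B (F \o G).
Proof. by move=> Bo BA sF sG n; apply: Cn_on_comp BA _ _. Qed.

Lemma smooth_on_id {V} (A : set V) : smooth_on A (fun x : V => x).
Proof.
case=> [|n]; first by move=> x _; exact: cvg_id.
split=> [x _|v]; first by apply: (@ex_diff _ _ _ _ _ id).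
rewrite [X in Cn_on _ _ X](_ : _ = fun=> v); first exact: Cn_on_cst.
by apply/funext => x; rewrite derive_id.
Qed.

Lemma smooth_on_dot {V} (A : set V) (F G : V -> 'rV[R]_3) : open A ->
  smooth_on A F -> smooth_on A G -> smooth_on A (fun x => dot (F x) (G x)).
Proof.
move=> Ao sF sG.
have sFG i : smooth_on A (fun x => F x 0 i * G x 0 i).
  by apply: smooth_onM => //; exact: smooth_on_coord.
apply: (@smooth_on_ext _ _ _ (fun x => F x 0 0 * G x 0 0 + F x 0 1 * G x 0 1
   + F x 0 2 * G x 0 2)) => // [x _|]; first by rewrite dot3E.
by do 2?apply: smooth_onD.
Qed.

Lemma smooth_on_det2 {V} (A : set V) (F G : V -> 'rV[R]_2) : open A ->
  smooth_on A F -> smooth_on A G -> smooth_on A (fun x => det2 (F x) (G x)).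
Proof.
move=> Ao sF sG.
have sFG i j : smooth_on A (fun x => F x 0 i * G x 0 j).
  by apply: smooth_onM => //; exact: smooth_on_coord.
apply: (@smooth_on_ext _ _ _ (fun x => F x 0 0 * G x 0 1 - F x 0 1 * G x 0 0))
  => // [x _|]; first by rewrite det2E.
exact: smooth_onB.
Qed.

Lemma smooth_on_det3 {V} (A : set V) (F G H : V -> 'rV[R]_3) : open A ->
  smooth_on A F -> smooth_on A G -> smooth_on A H ->
  smooth_on A (fun x => det3 (F x) (G x) (H x)).
Proof.
move=> Ao sF sG sH; have c := smooth_on_coord _ Ao.
apply: (@smooth_on_ext _ _ _ (fun x =>
  F x 0 0 * (G x 0 1 * H x 0 2 - G x 0 2 * H x 0 1) -
  F x 0 1 * (G x 0 0 * H x 0 2 - G x 0 2 * H x 0 0) +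
  F x 0 2 * (G x 0 0 * H x 0 1 - G x 0 1 * H x 0 0)))
  => // [x _|]; first by rewrite det3E.
have cM i j k : smooth_on A (fun x => F x 0 i * (G x 0 j * H x 0 k - G x 0 k * H x 0 j)).
  apply: smooth_onM (c _ _ _ sF) _ => //.
  by apply: smooth_onB => //; apply: smooth_onM => //; exact: c.
apply: smooth_onD (cM _ _ _) => //.
exact: smooth_onB (cM _ _ _) (cM _ _ _).
Qed.

Lemma derive_dot {V} (F G : V -> 'rV[R]_3) x v :
  differentiable F x -> differentiable G x ->
  'D_v (fun y => dot (F y) (G y)) x = dot ('D_v F x) (G x) + dot (F x) ('D_v G x).
Proof.
move=> dF dG.
have dFi i : derivable (fun y => F y 0 i) x v.
  by apply: diff_derivable; exact: (differentiable_rowP _ _).1.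
have dGi i : derivable (fun y => G y 0 i) x v.
  by apply: diff_derivable; exact: (differentiable_rowP _ _).1.
pose H i := (fun y => F y 0 i : R) * (fun y => G y 0 i : R).
rewrite (_ : (fun y => dot (F y) (G y)) = \sum_(i < 3) H i); last first.
  by apply/funext => y; rewrite fct_sumE.
rewrite derive_sum; last by move=> i; exact: derivableM.
rewrite /dot -big_split/=; apply: eq_bigr => i _.
rewrite deriveM// !derive_row// /GRing.scale/= addrC; congr (_ + _); exact: mulrC.
Qed.

Lemma derive_scaled {V} {k} (a : V -> R) (F : V -> 'rV[R]_k) x v :
  differentiable a x -> differentiable F x ->
  'D_v (fun y => a y *: F y) x = 'D_v a x *: F x + a x *: 'D_v F x.
Proof.
move=> da dF.
have dFi i : differentiable (fun y => F y 0 i) x by exact: (differentiable_rowP _ _).1.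
have dP : differentiable (fun y => a y *: F y) x.
  apply/differentiable_rowP => i.
  rewrite [X in differentiable X _](_ : _ = a * (fun y => F y 0 i)).
    exact: differentiableM.
  by apply/funext => y; rewrite mxE.
apply/rowP => i; rewrite derive_row// !mxE.
rewrite [X in 'D_v X _](_ : _ = a * (fun y => F y 0 i)); last first.
  by apply/funext => y; rewrite mxE.
rewrite deriveM//; [|exact: diff_derivable|exact: diff_derivable].
rewrite derive_row// /GRing.scale/= addrC; congr (_ + _); exact: mulrC.
Qed.

Lemma smooth_schwarz {V} {k} (A : set V) (F : V -> 'rV[R]_k) x v w :
  open A -> A x -> smooth_on A F -> 'D_v ('D_w F) x = 'D_w ('D_v F) x.
Proof.
move=> Ao Ax sF; apply/rowP => i.
have E u u' : 'D_u ('D_u' F) x 0 i = 'D_u ('D_u' (fun y => F y 0 i)) x.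
  rewrite derive_row; last first.
    exact: smooth_on_differentiable (smooth_on_derive _ sF) Ax.
  apply: near_eq_derive; near=> y; apply: derive_row.
  apply: (smooth_on_differentiable sF).
  by near: y; exact: open_nbhs_nbhs.
have CF : Cn_on 2 A (fun y => F y 0 i : R) := smooth_on_coord i Ao sF 2%N.
exact: etrans (E v w) (etrans (schwarz v w Ao Ax CF) (esym (E w v))).
Unshelve. all: by end_near. Qed.

End SmoothOn.

(** * Limits along lines *)

Section Limits.
Set Implicit Arguments.
Unset Strict Implicit.
Context {R : realType} {V : normedModType R}.

Lemma dnbhs0P (P : set R) : (\forall t \near (0 : R)^', P t) ->
  exists2 d : R, 0 < d & forall t, t != 0 -> `|t| < d -> P t.
Proof.
move=> /nbhs_ballP[d /= d0 Hd]; exists d => // t t0 td; apply: (Hd t) => //.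
by rewrite -ball_normE/= sub0r normrN.
Qed.

Lemma line_near (P : set V) (y u : V) : nbhs y P ->
  \forall t \near (0 : R)^', P (y + t *: u).
Proof.
move=> Py; apply: cvg_within.
have cl : y + t *: u @[t --> (0 : R)] --> y.
  rewrite -[X in _ --> X]addr0; apply: cvgD; first exact: cvg_cst.
  by rewrite -(scale0r u); apply: cvgZr_tmp; exact: cvg_id.
exact: (cl P Py).
Qed.

(** F >= 0 on one side of y and F <= 0 on the other one. *)
Lemma eq0_line (F : V -> R) (y u : V) : {for y, continuous F} ->
  (\forall t \near (0 : R)^', 0 <= t * F (y + t *: u)) -> F y = 0.
Proof.
move=> cF F0; have [//|Fy0] := eqVneq (F y) 0.
have Fs : \forall z \near y, 0 < F z * F y.
  have cFF : (fun z => F z * F y) @ y --> F y * F y.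
    by apply: cvgM; [exact: cF|exact: cvg_cst].
  by apply: cvgr_gt cFF _ _; rewrite -expr2 exprn_even_gt0.
have [d d0 Hd] := dnbhs0P (filterI F0 (line_near u Fs)).
have d20 : 0 < d / 2 by rewrite divr_gt0.
have dd : `|d / 2| < d by rewrite gtr0_norm// ltr_pdivrMr// ltr_pMr// ltr1n.
have [|A1 B1] := Hd (d / 2) _ dd; first by rewrite gt_eqF.
have [||A2 B2] := Hd (- (d / 2)); [by rewrite oppr_eq0 gt_eqF|by rewrite normrN|].
move: A1 A2; rewrite mulNr oppr_ge0 pmulr_rge0// pmulr_rle0// => A1 A2.
have [Fy|Fy|//] := ltgtP (F y) 0.
  by move: B1; rewrite nmulr_lgt0// ltNge A1.
by move: B2; rewrite pmulr_lgt0// ltNge A2.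
Qed.

Lemma ge0_line (F : V -> R) (y u : V) : {for y, continuous F} ->
  (\forall t \near (0 : R)^', 0 <= F (y + t *: u)) -> 0 <= F y.
Proof.
move=> cF F0; rewrite leNgt; apply/negP => Fy.
have Fs : \forall z \near y, F z < 0 by apply: cvgr_lt cF _ Fy.
have [d d0 Hd] := dnbhs0P (filterI F0 (line_near u Fs)).
have d20 : 0 < d / 2 by rewrite divr_gt0.
have [||A1] := Hd (d / 2); first by rewrite gt_eqF.
  by rewrite gtr0_norm// ltr_pdivrMr// ltr_pMr// ltr1n.
by rewrite ltNge A1.
Qed.

End Limits.

(** * Charts adapted to the null direction *)

Local Notation e0 := (basis_vec 0).
Local Notation e1 := (basis_vec 1).

Section Charts.
Set Implicit Arguments.
Unset Strict Implicit.
Context {R : realType}.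
Implicit Types (g ph n : 'rV[R]_2 -> 'rV[R]_3) (W : set 'rV[R]_2)
  (y : 'rV[R]_2).

(** A surface g with unit normal n whose velocity in the direction v is v times a
    field ph independent of the other velocity: the singular set is the axis v = 0.
    [ad_cross] says that, away from the origin, n_v does not vanish on the axis, so
    that g is a front there. *)
Record adapted_chart W g ph n : Prop := AdaptedChart {
  ad_open : open W;
  ad_g : smooth_on W g;
  ad_ph : smooth_on W ph;
  ad_n : smooth_on W n;
  ad_null : forall y, W y -> 'D_e1 g y = y 0 1 *: ph y;
  ad_unit : forall y, W y -> dot (n y) (n y) = 1;
  ad_perp_u : forall y, W y -> dot ('D_e0 g y) (n y) = 0;
  ad_perp_ph : forall y, W y -> dot (ph y) (n y) = 0;
  ad_indep : forall y, W y -> det3 ('D_e0 g y) (ph y) (n y) != 0;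
  ad_cross : forall y, W y -> y 0 1 = 0 -> y 0 0 != 0 ->
    dot ('D_e1 ph y) (n y) != 0 }.

(** The coefficients of the second fundamental form in the chart are [II_uu],
    v * [II_uv] and v * [II_vv]. *)
Definition II_uu g n y := dot ('D_e0 ('D_e0 g) y) (n y).
Definition II_uv ph n y := dot ('D_e0 ph y) (n y).
Definition II_vv ph n y := dot ('D_e1 ph y) (n y).
Definition frame_det g ph n y := det3 ('D_e0 g y) (ph y) (n y).
(** The quotient of the determinants computed in [second_form_det] and
    [first_form_det]. *)
Definition chart_curvature g ph n y : R :=
  (y 0 1 * (II_uu g n y * II_vv ph n y) - y 0 1 ^+ 2 * II_uv ph n y ^+ 2) /
  (y 0 1 ^+ 2 * frame_det g ph n y ^+ 2).
(** On the axis this has the sign of the singular curvature. *)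
Definition curvature_sign g ph n y :=
  frame_det g ph n y * det3 ('D_e0 g y) ('D_e0 ('D_e0 g) y) (n y).

Lemma basis_vecE (i j : 'I_2) : (basis_vec i : 'rV[R]_2) 0 j = (j == i)%:R.
Proof. by rewrite mxE. Qed.

Lemma row2E (y : 'rV[R]_2) : y = y 0 0 *: basis_vec 0 + y 0 1 *: basis_vec 1.
Proof.
apply/rowP => i; rewrite !mxE/=.
have [->|->] : i = 0 \/ i = 1; last 2 first.
- by rewrite /=; ring.
- by rewrite /=; ring.
by case: i => [[|[|//]]] ?; [left|right]; apply/val_inj.
Qed.

Lemma derive_coord {k} (i : 'I_k) (x v : 'rV[R]_k) :
  'D_v (fun y : 'rV[R]_k => y 0 i) x = v 0 i.
Proof.
have did : differentiable (fun y : 'rV[R]_k => y) x by apply: (@ex_diff _ _ _ _ _ id).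
by rewrite -(derive_row v i did) derive_id.
Qed.

Lemma smooth_on_proj {k} (i : 'I_k) (W : set 'rV[R]_k) : open W ->
  smooth_on W (fun y : 'rV[R]_k => y 0 i).
Proof. by move=> Wo; apply: smooth_on_coord => //; exact: smooth_on_id. Qed.

Lemma derive_u_scaled W (F : 'rV[R]_2 -> 'rV[R]_3) y : open W -> smooth_on W F -> W y ->
  'D_e0 (fun z : 'rV[R]_2 => z 0 1 *: F z) y = y 0 1 *: 'D_e0 F y.
Proof.
move=> Wo sF Wy.
have da := smooth_on_differentiable (smooth_on_proj 1 Wo) Wy.
have dF := smooth_on_differentiable sF Wy.
rewrite (@derive_scaled _ _ _ (fun z : 'rV[R]_2 => z 0 1) F y _ da dF).
by rewrite derive_coord basis_vecE scale0r add0r.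
Qed.

Lemma derive_dot_cst W (F G : 'rV[R]_2 -> 'rV[R]_3) (c : R) y v : open W ->
  smooth_on W F -> smooth_on W G -> (forall z, W z -> dot (F z) (G z) = c) -> W y ->
  dot ('D_v F y) (G y) = - dot (F y) ('D_v G y).
Proof.
move=> Wo sF sG FG Wy; apply/eqP; rewrite -addr_eq0; apply/eqP.
rewrite -derive_dot; try exact: smooth_on_differentiable Wy.
rewrite (@near_eq_derive _ _ _ _ (cst c)) ?derive_cst//.
by near=> z; apply: FG; near: z; exact: open_nbhs_nbhs.
Unshelve. all: by end_near. Qed.

Section ChartForms.
Variables (W : set 'rV[R]_2) (g ph n : 'rV[R]_2 -> 'rV[R]_3).
Hypothesis ad : adapted_chart W g ph n.

Let Wo := ad_open ad.
Let sg := ad_g ad.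
Let sph := ad_ph ad.
Let sn := ad_n ad.
Let sDg := smooth_on_derive e0 sg.
Let sDDg := smooth_on_derive e0 sDg.

Lemma near_chart (P : set 'rV[R]_2) y :
  W y -> (forall z, W z -> P z) -> \forall z \near y, P z.
Proof.
by move=> Wy WP; near=> z; apply: WP; near: z; exact: open_nbhs_nbhs.
Unshelve. all: by end_near. Qed.

(** g_uv = (g_v)_u = (v ph)_u.  This is where the symmetry of second derivatives
    enters: it makes both mixed coefficients of the second fundamental form equal to
    v <ph_u, n>, so that they contribute a square to the curvature. *)
Lemma chart_derive_uv y : W y -> 'D_e1 ('D_e0 g) y = y 0 1 *: 'D_e0 ph y.
Proof.
move=> Wy; rewrite (smooth_schwarz e1 e0 Wo Wy sg).
rewrite (@near_eq_derive _ _ _ _ (fun z : 'rV[R]_2 => z 0 1 *: ph z)).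
  exact: derive_u_scaled sph Wy.
by apply: near_chart => // z; exact: ad_null ad _.
Qed.

Lemma chart_derive_uuv y : W y -> 'D_e1 ('D_e0 ('D_e0 g)) y = y 0 1 *: 'D_e0 ('D_e0 ph) y.
Proof.
move=> Wy; rewrite (smooth_schwarz e1 e0 Wo Wy sDg).
rewrite (@near_eq_derive _ _ _ _ (fun z : 'rV[R]_2 => z 0 1 *: 'D_e0 ph z)).
  exact: derive_u_scaled (smooth_on_derive _ sph) Wy.
by apply: near_chart => // z; exact: chart_derive_uv.
Qed.

Lemma dot_gu_nu y : W y -> dot ('D_e0 g y) ('D_e0 n y) = - II_uu g n y.
Proof.
move=> Wy; rewrite /II_uu (derive_dot_cst e0 Wo sDg sn (ad_perp_u ad) Wy).
by rewrite opprK.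
Qed.

Lemma dot_gu_nv y : W y -> dot ('D_e0 g y) ('D_e1 n y) = - (y 0 1 * II_uv ph n y).
Proof.
move=> Wy; rewrite /II_uv -dotZl -chart_derive_uv//.
by rewrite (derive_dot_cst e1 Wo sDg sn (ad_perp_u ad) Wy) opprK.
Qed.

Lemma dot_ph_nu y : W y -> dot (ph y) ('D_e0 n y) = - II_uv ph n y.
Proof.
move=> Wy; rewrite /II_uv (derive_dot_cst e0 Wo sph sn (ad_perp_ph ad) Wy).
by rewrite opprK.
Qed.

Lemma dot_ph_nv y : W y -> dot (ph y) ('D_e1 n y) = - II_vv ph n y.
Proof.
move=> Wy; rewrite /II_vv (derive_dot_cst e1 Wo sph sn (ad_perp_ph ad) Wy).
by rewrite opprK.
Qed.

Lemma dot_n_nv y : W y -> dot (n y) ('D_e1 n y) = 0.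
Proof.
move=> Wy; have := derive_dot_cst e1 Wo sn sn (ad_unit ad) Wy.
by rewrite dotC => /eqP; rewrite -addr_eq0 -mulr2n mulrn_eq0/= => /eqP.
Qed.

Lemma second_form_det y : W y ->
  dot ('D_e0 g y) ('D_e0 n y) * dot ('D_e1 g y) ('D_e1 n y) -
  dot ('D_e0 g y) ('D_e1 n y) * dot ('D_e1 g y) ('D_e0 n y) =
  y 0 1 * (II_uu g n y * II_vv ph n y) - y 0 1 ^+ 2 * II_uv ph n y ^+ 2.
Proof.
move=> Wy; rewrite (ad_null ad Wy) !dotZl.
by rewrite dot_gu_nu// dot_gu_nv// dot_ph_nu// dot_ph_nv//; ring.
Qed.

(** <g_u, g_u> <ph, ph> - <g_u, ph>^2 is the square of det(g_u, ph, n), because n is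
    a unit vector orthogonal to g_u and ph. *)
Lemma first_form_det y : W y ->
  dot ('D_e0 g y) ('D_e0 g y) * dot ('D_e1 g y) ('D_e1 g y) -
  dot ('D_e0 g y) ('D_e1 g y) * dot ('D_e1 g y) ('D_e0 g y) =
  y 0 1 ^+ 2 * frame_det g ph n y ^+ 2.
Proof.
move=> Wy; rewrite (ad_null ad Wy) !(dotZl, dotZr) [frame_det _ _ _ _ ^+ 2]expr2 /frame_det.
rewrite det3_normal_gram; [|exact: ad_perp_u ad _ Wy|exact: ad_perp_ph ad _ Wy].
by rewrite (ad_unit ad Wy) (dotC (ph y) ('D_e0 g y)); ring.
Qed.

Lemma chart_curvature_singular y : y 0 1 = 0 -> chart_curvature g ph n y = 0.
Proof. by move=> y0; rewrite /chart_curvature y0 expr0n !mul0r subrr mul0r. Qed.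

Lemma chart_curvatureE y : W y -> y 0 1 != 0 ->
  II_uu g n y * II_vv ph n y =
  y 0 1 * (chart_curvature g ph n y * frame_det g ph n y ^+ 2 + II_uv ph n y ^+ 2).
Proof.
move=> Wy y0; have T0 : frame_det g ph n y != 0 := ad_indep ad Wy.
by rewrite /chart_curvature; field; rewrite y0 T0.
Qed.

Lemma smooth_II_uu : smooth_on W (II_uu g n). Proof. exact: smooth_on_dot. Qed.
Lemma smooth_II_uv : smooth_on W (II_uv ph n).
Proof. exact: smooth_on_dot Wo (smooth_on_derive _ sph) sn. Qed.
Lemma smooth_II_vv : smooth_on W (II_vv ph n).
Proof. exact: smooth_on_dot Wo (smooth_on_derive _ sph) sn. Qed.
Lemma smooth_frame_det : smooth_on W (frame_det g ph n). Proof. exact: smooth_on_det3. Qed.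
Lemma smooth_curvature_sign : smooth_on W (curvature_sign g ph n).
Proof. by apply: smooth_onM; [|exact: smooth_frame_det|exact: smooth_on_det3]. Qed.

End ChartForms.
End Charts.

(** * Curvature near the singular axis *)

Section CurvatureNearAxis.
Set Implicit Arguments.
Unset Strict Implicit.
Context {R : realType}.

Lemma bounded_closed_ball (F : 'rV[R]_2 -> R) (r : R) :
  (forall y, `|y| <= r -> {for y, continuous F}) ->
  exists2 C : R, 0 <= C & forall y, `|y| <= r -> `|F y| <= C.
Proof.
move=> cF; have [r0|r0] := ltP r 0.
  by exists 0 => // y /le_lt_trans/(_ r0); rewrite ltNge normr_ge0.
pose A := [set y : 'rV[R]_2 | `|y| <= r].
have cA : compact A.
  apply: bounded_closed_compact.
    by exists r; split; [exact: num_real|move=> x rx y /= /le_trans; apply; exact: ltW].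
  by apply: closed_comp (@closed_le R r) => y _; exact: norm_continuous.
have cF' : {within A, continuous (fun y => `|F y|)}.
  apply: continuous_in_subspaceT => y; rewrite inE => Ay.
  by apply: continuous_comp; [exact: cF|exact: norm_continuous].
have A0 : A !=set0 by exists 0; rewrite /A/= normr0.
have [c cAc Hc] := EVT_max_rV A0 cA cF'.
by exists `|F c| => // y Ay; apply: Hc; rewrite inE.
Qed.

Lemma norm_row2_le (y : 'rV[R]_2) (c : R) :
  `|y| <= c <-> `|y 0 0| <= c /\ `|y 0 1| <= c.
Proof.
rewrite /Num.Def.normr/= mx_normrE; split=> [yc|[c0 c1]].
  split.
    exact: le_trans (le_bigmax _ (fun i => `|y i.1 i.2|) (0, 0)) yc.
  exact: le_trans (le_bigmax _ (fun i => `|y i.1 i.2|) (0, 1)) yc.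
apply: bigmax_le; first exact: le_trans (normr_ge0 _) c0.
move=> [i j] _ /=; rewrite (ord1 i).
have [->|->] : j = 0 \/ j = 1; last 2 first.
- exact: c0.
- exact: c1.
by case: j => [[|[|//]]] ?; [left|right]; apply/val_inj.
Qed.

(** A ball of the supremum norm contains, with a point, the vertical segment joining
    it to the axis. *)
Lemma norm_segment (y : 'rV[R]_2) (s : R) : 0 <= s <= 1 ->
  `|y 0 0 *: e0 + s *: (y 0 1 *: e1)| <= `|y|.
Proof.
move=> /andP[s0 s1]; have [y0 y1] := (norm_row2_le y `|y|).1 (lexx _).
apply/norm_row2_le; rewrite !mxE/= !(mulr0, mulr1, add0r, addr0); split=> //.
by rewrite normrM (ger0_norm s0) (le_trans _ y1)// ler_piMl.
Qed.

Section AxisLimits.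
Variables (W : set 'rV[R]_2) (g ph n : 'rV[R]_2 -> 'rV[R]_3).
Hypothesis ad : adapted_chart W g ph n.
Let Wo := ad_open ad.
Implicit Types (O : set 'rV[R]_2) (y : 'rV[R]_2) (t : R).

Let contW (F : 'rV[R]_2 -> R) y : smooth_on W F -> W y -> {for y, continuous F}.
Proof. exact: smooth_on_continuous. Qed.

Lemma add_e1E y t : y 0 1 = 0 -> (y + t *: e1) 0 1 = t.
Proof. by move=> y0; rewrite !mxE y0/=; ring. Qed.

Lemma add_e0E y t : ((y + t *: e0) 0 1 = y 0 1) * ((y + t *: e0) 0 0 = y 0 0 + t).
Proof. by rewrite !mxE/=; split; ring. Qed.

(** Carries a sign from the rest of the axis to the origin, where the factor
    [II_vv] may vanish and cannot be cancelled. *)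
Lemma ge0_on_axis O (F : 'rV[R]_2 -> R) : open O -> O `<=` W -> smooth_on W F ->
  (forall y, O y -> y 0 1 = 0 -> y 0 0 != 0 -> 0 <= F y) ->
  forall y, O y -> y 0 1 = 0 -> 0 <= F y.
Proof.
move=> Oo OW sF F0 y Oy y1; have [y0|y0] := eqVneq (y 0 0) 0; last exact: F0.
apply: (@ge0_line _ _ F y e0); first exact: contW sF (OW _ Oy).
have nO : nbhs y O by exact: open_nbhs_nbhs.
near=> t; apply: F0; first by near: t; exact: line_near.
  by rewrite add_e0E.
by rewrite add_e0E y0 add0r; near: t; exact: nbhs_dnbhs_neq.
Unshelve. all: by end_near. Qed.

(** As v tends to 0 with bounded curvature, the right-hand side of
    [chart_curvatureE] tends to 0, so II_uu * II_vv vanishes on the axis; II_vv can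
    be cancelled except at the origin. *)
Lemma flat_of_bounded O (M0 : R) : open O -> O `<=` W ->
  (forall y, O y -> y 0 1 != 0 -> `|chart_curvature g ph n y| <= M0) ->
  forall y, O y -> y 0 1 = 0 -> II_uu g n y = 0.
Proof.
move=> Oo OW KM.
have LN y : O y -> y 0 1 = 0 -> II_uu g n y * II_vv ph n y = 0.
  move=> Oy y1; have Wy := OW _ Oy.
  (* H bounds II_uu * II_vv; squares are compared to keep all functions smooth. *)
  pose H (z : 'rV[R]_2) := (z 0 1 : R) * (M0 * frame_det g ph n z ^+ 2 + II_uv ph n z ^+ 2).
  pose LNz z := II_uu g n z * II_vv ph n z.
  have sLN : smooth_on W LNz := smooth_onM Wo (smooth_II_uu ad) (smooth_II_vv ad).
  have sH : smooth_on W H.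
    apply: smooth_onM (smooth_on_proj 1 Wo) _ => //.
    apply: smooth_onD; [by []| |exact: smooth_onM (smooth_II_uv ad) (smooth_II_uv ad)].
    apply: smooth_onM => //; first exact: smooth_on_cst.
    exact: smooth_onM (smooth_frame_det ad) (smooth_frame_det ad).
  have sHL := smooth_onB Wo (smooth_onM Wo sH sH) (smooth_onM Wo sLN sLN).
  have := @ge0_line _ _ _ y e1 (contW sHL Wy) _.
  have H0 : H y = 0 by rewrite /H y1 mul0r.
  rewrite H0 mul0r sub0r.
  rewrite oppr_ge0 -expr2 => sq0; apply/eqP; rewrite -sqrf_eq0 eq_le sqr_ge0 andbT.
  apply: sq0; have nO : nbhs y O by exact: open_nbhs_nbhs.
  near=> t.
  have t0 : t != 0 by near: t; exact: nbhs_dnbhs_neq.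
  have Oz : O (y + t *: e1) by near: t; exact: line_near.
  have z0 : (y + t *: e1) 0 1 != 0 by rewrite add_e1E.
  rewrite subr_ge0 -!expr2 /LNz (chart_curvatureE ad (OW _ Oz) z0) /H !exprMn.
  rewrite ler_wpM2l ?sqr_ge0// -[leLHS]real_normK ?num_real// lerXn2r//.
    have M00 := le_trans (normr_ge0 _) (KM _ Oz z0).
    rewrite nnegrE; apply: addr_ge0 (sqr_ge0 _).
    exact: mulr_ge0 M00 (sqr_ge0 _).
  rewrite (le_trans (ler_normD _ _))// normrM !(ger0_norm (sqr_ge0 _)) lerD2r.
  by rewrite ler_wpM2r ?sqr_ge0//; exact: KM.
have L0 y : O y -> y 0 1 = 0 -> y 0 0 != 0 -> II_uu g n y = 0.
  move=> Oy y1 y0; have /eqP := LN _ Oy y1.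
  by rewrite mulf_eq0 (negPf (ad_cross ad (OW _ Oy) y1 y0)) orbF => /eqP.
move=> y Oy y1; apply/eqP; rewrite eq_le; apply/andP; split.
  rewrite -oppr_ge0; have sN' : smooth_on W (fun y => 0 - II_uu g n y).
    by apply: smooth_onB => //; [exact: smooth_on_cst|exact: smooth_II_uu ad].
  have := ge0_on_axis Oo OW sN' _ Oy y1; rewrite sub0r; apply => z Oz z1 z0.
  by rewrite L0// subr0.
by apply: (ge0_on_axis Oo OW (smooth_II_uu ad) _ Oy y1) => z Oz z1 z0; rewrite L0.
Unshelve. all: by end_near. Qed.

(** Nonnegative curvature makes II_uu * II_vv / v nonnegative.  Hence II_uu vanishes
    on the axis, and the limit of the quotient is (II_uu)_v * II_vv >= 0, that is
    <g_uu, n_v> <ph, n_v> <= 0; [det3_sign] with x = n_v turns this into a statement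
    on determinants. *)
Lemma sign_of_nonneg O : open O -> O `<=` W ->
  (forall y, O y -> y 0 1 != 0 -> 0 <= chart_curvature g ph n y) ->
  forall y, O y -> y 0 1 = 0 -> curvature_sign g ph n y <= 0.
Proof.
move=> Oo OW K0.
suff S0 y : O y -> y 0 1 = 0 -> y 0 0 != 0 -> curvature_sign g ph n y <= 0.
  move=> y Oy y1; rewrite -oppr_ge0 -sub0r.
  have sS' : smooth_on W (fun y => 0 - curvature_sign g ph n y).
    by apply: smooth_onB => //; [exact: smooth_on_cst|exact: smooth_curvature_sign ad].
  by apply: (ge0_on_axis Oo OW sS' _ Oy y1) => z Oz z1 z0; rewrite subr_ge0 S0.
move=> Oy y1 y0; have Wy := OW _ Oy.
have cN := contW (smooth_II_vv ad) Wy.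
have nO : nbhs y O by exact: open_nbhs_nbhs.
have K t : t != 0 -> O (y + t *: e1) ->
    exists2 c : R, 0 <= c & II_uu g n (y + t *: e1) * II_vv ph n (y + t *: e1) = t * c.
  move=> t0 Oz; have Ez := add_e1E t y1.
  have z0 : (y + t *: e1) 0 1 != 0 by rewrite Ez.
  have := chart_curvatureE ad (OW _ Oz) z0; rewrite Ez => ->; eexists; last by [].
  by rewrite addr_ge0 ?sqr_ge0// mulr_ge0 ?sqr_ge0// K0.
have LN0 : II_uu g n y * II_vv ph n y = 0.
  apply: (@eq0_line _ _ (fun z => II_uu g n z * II_vv ph n z) y e1).
    exact: contW (smooth_onM Wo (smooth_II_uu ad) (smooth_II_vv ad)) Wy.
  near=> t.
  have [||c c0 ->] := K t; first by near: t; exact: nbhs_dnbhs_neq.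
    by near: t; exact: line_near.
  by rewrite mulrA mulr_ge0// -expr2 sqr_ge0.
have N0 : II_vv ph n y != 0 := ad_cross ad Wy y1 y0.
have L0 : II_uu g n y = 0 by move/eqP: LN0; rewrite mulf_eq0 (negPf N0) orbF => /eqP.
have DLN : 0 <= 'D_e1 (II_uu g n) y * II_vv ph n y.
  have cD : h^-1 * II_uu g n (y + h *: e1) @[h --> (0 : R)^'] --> 'D_e1 (II_uu g n) y.
    have := cvg_difference_quotient (smooth_on_derivable (v := e1) (smooth_II_uu ad) Wy).
    by under eq_fun do rewrite L0 subr0.
  have cNt : II_vv ph n (y + t *: e1) @[t --> (0 : R)^'] --> II_vv ph n y.
    by move=> P /cN/line_near; exact.
  have cDN := @cvgM _ _ _ (dnbhs_filter (0 : R)) _ _ _ _ cD cNt.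
  rewrite -(cvg_lim _ cDN)//; apply: limr_ge.
    by apply/cvg_ex; eexists; exact: cDN.
  near=> t.
  have t0 : t != 0 by near: t; exact: nbhs_dnbhs_neq.
  have [|c c0 E] := K t t0; first by near: t; exact: line_near.
  by rewrite /= -mulrA E mulKf.
(* The other term <g_uuv, n> vanishes on the axis, since g_uuv = v ph_uu. *)
have DL : 'D_e1 (II_uu g n) y = dot ('D_e0 ('D_e0 g) y) ('D_e1 n y).
  have sDDg := smooth_on_derive e0 (smooth_on_derive e0 (ad_g ad)).
  rewrite derive_dot.
  - by rewrite (chart_derive_uuv ad Wy) y1 scale0r dot0l add0r.
  - exact: smooth_on_differentiable sDDg Wy.
  - exact: smooth_on_differentiable (ad_n ad) Wy.
have EN := dot_ph_nv ad Wy.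
apply: (@det3_sign _ ('D_e0 g y) (ph y) ('D_e0 ('D_e0 g) y) (n y) ('D_e1 n y)).
- by rewrite (dot_gu_nv ad Wy) y1 mul0r oppr0.
- exact: (dot_n_nv ad Wy).
- exact: (ad_perp_u ad Wy).
- exact: (ad_unit ad Wy).
- by rewrite EN oppr_eq0.
- exact: (ad_indep ad Wy).
- by rewrite EN mulrN oppr_le0 -DL.
Unshelve. all: by end_near. Qed.

End AxisLimits.

(** By the mean value theorem between a point and its projection to the axis, II_uu
    is v times a value of its v-derivative; so the quotient defining the curvature is
    bounded by continuity on a closed ball.  Flatness is assumed over a set I of
    abscissas only, because the curve J need not fill the axis of the ball. *)
Lemma bounded_of_flat (r r' : R) (g ph n : 'rV[R]_2 -> 'rV[R]_3) (I : set R) :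
  r' < r -> adapted_chart (ball 0 r) g ph n ->
  (forall u : R, I u -> `|u| < r -> II_uu g n (u *: e0) = 0) ->
  exists M0 : R, forall y : 'rV[R]_2, `|y| <= r' -> I (y 0 0) -> y 0 1 != 0 ->
    `|chart_curvature g ph n y| <= M0.
Proof.
move=> rr ad flat; pose W : set 'rV[R]_2 := ball 0 r.
have inW (y : 'rV[R]_2) : `|y| <= r' -> W y.
  by move=> yr; rewrite /W -ball_normE/= sub0r normrN (le_lt_trans yr).
have Wo : open W := ad_open ad.
have sDL : smooth_on W ('D_e1 (II_uu g n)) := smooth_on_derive e1 (smooth_II_uu ad).
have cW (F : 'rV[R]_2 -> R) : smooth_on W F ->
    forall y, `|y| <= r' -> {for y, continuous F}.
  by move=> sF y /inW; exact: smooth_on_continuous.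
have [C1 C10 B1] := bounded_closed_ball (cW _ sDL).
have [C2 C20 B2] := bounded_closed_ball (cW _ (smooth_II_vv ad)).
have sM2 := smooth_onM Wo (smooth_II_uv ad) (smooth_II_uv ad).
have [C3 C30 B3] := bounded_closed_ball (cW _ sM2).
have cT y : `|y| <= r' -> {for y, continuous (fun y => (frame_det g ph n y ^+ 2)^-1)}.
  move=> yr; have T0 : frame_det g ph n y ^+ 2 != 0.
    by rewrite sqrf_eq0; exact: (ad_indep ad (inW _ yr)).
  have c : {for y, continuous (fun y => frame_det g ph n y ^+ 2)}.
    exact: (cW _ (smooth_onM Wo (smooth_frame_det ad) (smooth_frame_det ad)) _ yr).
  exact: cvgV T0 c.
have [C4 C40 B4] := bounded_closed_ball cT.
exists ((C1 * C2 + C3) * C4) => y yr Iy y1.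
have [s /andP[s0 s1] EL] : exists2 s : R, 0 <= s <= 1 &
    II_uu g n y = y 0 1 * 'D_e1 (II_uu g n) (y 0 0 *: e0 + s *: (y 0 1 *: e1)).
  have segW (s : R) : 0 <= s <= 1 -> W (y 0 0 *: e0 + s *: (y 0 1 *: e1)).
    by move=> s01; apply: inW; exact: le_trans (norm_segment y s01) yr.
  have [|s s01 Es] := @MVT_line _ _ (II_uu g n) (y 0 0 *: e0) (y 0 1 *: e1).
    by move=> s s01; exact: smooth_on_differentiable (smooth_II_uu ad) (segW s s01).
  exists s => //; move: Es; rewrite -row2E derive_scale; last first.
    exact: smooth_on_differentiable (smooth_II_uu ad) (segW s s01).
  rewrite flat ?subr0// (le_lt_trans _ (le_lt_trans yr rr))//.
  exact: ((norm_row2_le y `|y|).1 (lexx _)).1.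
set z := _ + _ in EL.
have zr : `|z| <= r' by apply: le_trans (norm_segment y _) yr; rewrite s0.
have T0 : frame_det g ph n y != 0 := ad_indep ad (inW _ yr).
have -> : chart_curvature g ph n y =
    ('D_e1 (II_uu g n) z * II_vv ph n y - II_uv ph n y * II_uv ph n y) *
    (frame_det g ph n y ^+ 2)^-1.
  rewrite /chart_curvature EL; move: ('D_e1 (II_uu g n) z) => d.
  by field; rewrite y1 T0.
rewrite normrM ler_pM//; last exact: B4.
rewrite (le_trans (ler_normB _ _))// lerD//; last exact: B3.
by rewrite normrM ler_pM//; [exact: B1|exact: B2].
Qed.

End CurvatureNearAxis.

Local Opaque diff basis_vec.

(** * Change of coordinates *)

Section Transfer.
Set Implicit Arguments.
Unset Strict Implicit.
Context {R : realType}.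

Lemma derive_compE {V V' W : normedModType R} (F : V' -> W) (G : V -> V') x v :
  differentiable G x -> differentiable F (G x) ->
  'D_v (F \o G) x = 'd F (G x) ('D_v G x).
Proof.
move=> dG dF; rewrite deriveE; last exact: differentiable_comp.
by rewrite diff_comp//= (deriveE v dG).
Qed.

Lemma diffeo_diffK {V : normedModType R} (A B : set V) (h k : V -> V) x v :
  diffeo A B h k -> A x -> 'd k (h x) ('d h x v) = v.
Proof.
move=> [[Ao Bo sh sk] [AB BA kh _]] Ax.
have dh : differentiable h x := smooth_on_differentiable sh Ax.
have dk : differentiable k (h x) := smooth_on_differentiable sk (AB _ Ax).
rewrite -(deriveE v dh) -derive_compE//.
rewrite (@near_eq_derive _ _ _ _ id) ?derive_id//.
near=> z; apply: kh; near: z; exact: open_nbhs_nbhs.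
Unshelve. all: by end_near. Qed.

Lemma diffeo_sym {V : normedModType R} (A B : set V) (h k : V -> V) :
  diffeo A B h k -> diffeo B A k h.
Proof. by move=> [[? ? ? ?] [? ? ? ?]]. Qed.

Lemma linear_row2E {W : lmodType R} (L : {linear 'rV[R]_2 -> W}) (v : 'rV[R]_2) :
  L v = v 0 0 *: L e0 + v 0 1 *: L e1.
Proof. by rewrite -!linearZ -linearD -row2E. Qed.

Lemma linear_row3E {W : lmodType R} (L : {linear 'rV[R]_3 -> W}) (v : 'rV[R]_3) :
  L v = v 0 0 *: L 'e_0 + v 0 1 *: L 'e_1 + v 0 2 *: L 'e_2.
Proof.
rewrite -!linearZ -!linearD; congr (L _).
by rewrite [LHS]row_sum_delta !big_ord_recl big_ord0 addr0 addrA !ord3E.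
Qed.

Lemma det2_linear (L : {linear 'rV[R]_2 -> 'rV[R]_2}) (a b : 'rV[R]_2) :
  det2 (L a) (L b) = det2 a b * det2 (L e0) (L e1).
Proof.
rewrite (linear_row2E L a) (linear_row2E L b); move: (L e0) (L e1) => p q.
by rewrite !det2E !mxE; ring.
Qed.

Lemma det3_linear (L : {linear 'rV[R]_3 -> 'rV[R]_3}) (a b c : 'rV[R]_3) :
  det3 (L a) (L b) (L c) = det3 a b c * det3 (L 'e_0) (L 'e_1) (L 'e_2).
Proof.
rewrite (linear_row3E L a) (linear_row3E L b) (linear_row3E L c).
move: (L 'e_0) (L 'e_1) (L 'e_2) => p q r.
by rewrite !det3E !mxE; ring.
Qed.

(** Both fundamental forms are obtained from pairs of linear maps in this way, so
    their determinants change by the same factor and the Gaussian curvature can be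
    computed in any basis. *)
Lemma gram_linear (A B : {linear 'rV[R]_2 -> 'rV[R]_3}) (a b : 'rV[R]_2) :
  dot (A a) (B a) * dot (A b) (B b) - dot (A a) (B b) * dot (A b) (B a) =
  det2 a b ^+ 2 * (dot (A e0) (B e0) * dot (A e1) (B e1) -
                   dot (A e0) (B e1) * dot (A e1) (B e0)).
Proof.
rewrite (linear_row2E A a) (linear_row2E A b) (linear_row2E B a) (linear_row2E B b).
move: (A e0) (A e1) (B e0) (B e1) => p q p' q'.
by rewrite !(dotDl, dotDr) !(dotZl, dotZr) det2E; ring.
Qed.

Lemma diffeo_det2 (A B : set 'rV[R]_2) (h k : 'rV[R]_2 -> 'rV[R]_2) x :
  diffeo A B h k -> A x -> det2 ('D_e0 h x) ('D_e1 h x) != 0.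
Proof.
move=> hk Ax; have [[_ _ sh _] _] := hk.
have dh : differentiable h x := smooth_on_differentiable sh Ax.
have K v : v = 'd k (h x) ('D_v h x) by rewrite (deriveE v dh) (diffeo_diffK v hk Ax).
have E : det2 (e0 : 'rV[R]_2) e1 = 1 by rewrite det2E !basis_vecE/=; ring.
have E2 : det2 ('D_e0 h x) ('D_e1 h x) * det2 ('d k (h x) e0) ('d k (h x) e1) = 1.
  by rewrite -det2_linear; apply: etrans E; congr det2; exact/esym/K.
have : det2 ('D_e0 h x) ('D_e1 h x) * det2 ('d k (h x) e0) ('d k (h x) e1) != 0.
  by rewrite E2 oner_neq0.
by apply: contraNneq => ->; rewrite mul0r.
Qed.

Lemma diffeo_det3 (A B : set 'rV[R]_3) (h k : 'rV[R]_3 -> 'rV[R]_3) x :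
  diffeo A B h k -> A x -> det3 ('D_('e_0) h x) ('D_('e_1) h x) ('D_('e_2) h x) != 0.
Proof.
move=> hk Ax; have [[_ _ sh _] _] := hk.
have dh : differentiable h x := smooth_on_differentiable sh Ax.
have K v : v = 'd k (h x) ('D_v h x) by rewrite (deriveE v dh) (diffeo_diffK v hk Ax).
have E : det3 ('e_0 : 'rV[R]_3) 'e_1 'e_2 = 1 by rewrite det3E !mxE/=; ring.
have E2 : det3 ('D_('e_0) h x) ('D_('e_1) h x) ('D_('e_2) h x) *
    det3 ('d k (h x) 'e_0) ('d k (h x) 'e_1) ('d k (h x) 'e_2) = 1.
  by rewrite -det3_linear; apply: etrans E; congr det3; exact/esym/K.
have : det3 ('D_('e_0) h x) ('D_('e_1) h x) ('D_('e_2) h x) *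
    det3 ('d k (h x) 'e_0) ('d k (h x) 'e_1) ('d k (h x) 'e_2) != 0.
  by rewrite E2 oner_neq0.
by apply: contraNneq => ->; rewrite mul0r.
Qed.

Lemma singular_null (f : 'rV[R]_2 -> 'rV[R]_3) q : singular_point f q ->
  exists2 v : 'rV[R]_2, v != 0 & 'd f q v = 0.
Proof.
rewrite /singular_point => rk.
have /rowV0Pn[v vk v0] : kermx ('J f q) != 0.
  by rewrite kermx_eq0 /row_free neq_ltn rk.
exists v => //; move/sub_kermxP : vk.
by rewrite /jacobian mul_rV_lin1.
Qed.

Section InCoordinates.
Variables (U A B : set 'rV[R]_2) (f nu ph : 'rV[R]_2 -> 'rV[R]_3)
  (phi psi : 'rV[R]_2 -> 'rV[R]_2) (W : set 'rV[R]_2).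
Hypotheses (Fr : frontal U f nu) (D : diffeo A B phi psi) (WB : W `<=` B)
  (WU : forall y, W y -> U (psi y)) (ad : adapted_chart W (f \o psi) ph (nu \o psi)).

Let dpsi y : W y -> differentiable psi y.
Proof. by move=> /WB By; have [[_ _ _ s] _] := D; exact: smooth_on_differentiable By. Qed.
Let df y : W y -> differentiable f (psi y).
Proof. by move=> /WU Uy; have [s _ _ _] := Fr; exact: smooth_on_differentiable Uy. Qed.
Let dnu y : W y -> differentiable nu (psi y).
Proof. by move=> /WU Uy; have [_ s _ _] := Fr; exact: smooth_on_differentiable Uy. Qed.

Lemma derive_f_psi y v : W y -> 'D_v (f \o psi) y = 'd f (psi y) ('D_v psi y).
Proof. by move=> Wy; apply: derive_compE; [exact: dpsi|exact: df]. Qed.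

Lemma derive_nu_psi y v : W y -> 'D_v (nu \o psi) y = 'd nu (psi y) ('D_v psi y).
Proof. by move=> Wy; apply: derive_compE; [exact: dpsi|exact: dnu]. Qed.

Lemma det2_psi y : W y -> det2 ('D_e0 psi y) ('D_e1 psi y) != 0.
Proof. by move=> /WB By; exact: diffeo_det2 (diffeo_sym D) By. Qed.

Lemma curvature_coord y : W y ->
  gaussian_curvature f nu (psi y) = chart_curvature (f \o psi) ph (nu \o psi) y.
Proof.
move=> Wy; rewrite /gaussian_curvature !det_mx22 !mxE /second_form /first_form !mulrNN.
have D2 : det2 ('D_e0 psi y) ('D_e1 psi y) ^+ 2 != 0 by rewrite sqrf_eq0 det2_psi.
rewrite /chart_curvature -(second_form_det ad Wy) -(first_form_det ad Wy).
rewrite (derive_f_psi e0 Wy).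
rewrite (derive_f_psi e1 Wy).
rewrite (derive_nu_psi e0 Wy) (derive_nu_psi e1 Wy).
move: ('D_e0 psi y) ('D_e1 psi y) D2 => P Q D2.
move: ('d f (psi y)) ('d nu (psi y)) => F N.
rewrite (gram_linear F N P Q) (gram_linear F F P Q).
by rewrite -mulf_div divff// mul1r.
Qed.

(** A null vector at a point with v != 0 would be a linear relation between g_u and
    v ph. *)
Lemma singular_coord y : W y -> singular_point f (psi y) -> y 0 1 = 0.
Proof.
move=> Wy /singular_null[v v0 dv]; apply/eqP; apply: contraTT isT => y1.
have [_ [_ _ _ pk]] := D; have By := WB Wy.
have [[_ _ sphi _] [_ BA _ _]] := D.
pose w := 'd phi (psi y) v.
have Ev : 'd psi y w = v.
  by have := diffeo_diffK v D (BA _ By); rewrite pk.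
have w0 : w != 0.
  by apply: contraNneq v0 => w0; rewrite -Ev w0 linear0.
have E : w 0 0 *: 'D_e0 (f \o psi) y + (w 0 1 * y 0 1) *: ph y = 0.
  rewrite -scalerA -(ad_null ad Wy) !derive_f_psi// -!linearZ -linearD.
  by rewrite !(deriveE _ (dpsi Wy)) -!linearZ -linearD -row2E Ev.
have T0 := ad_indep ad Wy.
have comb (a b : R) (x1 x2 x3 : 'rV[R]_3) : a *: x1 + b *: x2 = 0 ->
    det3 x1 x2 x3 != 0 -> a = 0 /\ b = 0.
  move=> E0 T.
  have Ea : a * det3 x1 x2 x3 = 0.
    rewrite (_ : _ * _ = det3 (a *: x1 + b *: x2) x2 x3).
      by rewrite E0 det3E !mxE; ring.
    by rewrite !det3E !mxE; ring.
  have Eb : b * det3 x1 x2 x3 = 0.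
    rewrite (_ : _ * _ = det3 x1 (a *: x1 + b *: x2) x3).
      by rewrite E0 det3E !mxE; ring.
    by rewrite !det3E !mxE; ring.
  by split; apply/eqP; [move/eqP: Ea|move/eqP: Eb]; rewrite mulf_eq0 (negPf T) orbF.
have [w00 /eqP] := comb _ _ _ _ _ E T0; rewrite mulf_eq0 (negPf y1) orbF => /eqP w01.
by case/negP: w0; rewrite (row2E w) w00 w01 !scale0r addr0.
Qed.

End InCoordinates.
End Transfer.

(** * The adapted chart of a cuspidal cross cap *)

Section CrossCap.
Set Implicit Arguments.
Unset Strict Implicit.
Context {R : realType}.

Local Notation std := (@standard_cuspidal_cross_cap R).

Lemma smooth_std (W : set 'rV[R]_2) : open W -> smooth_on W std.
Proof.
move=> Wo; have s0 := smooth_on_proj 0 Wo; have s1 := smooth_on_proj 1 Wo.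
have s11 := smooth_onM Wo s1 s1.
apply: smooth_on_row => // i.
have [->|->|->] : [\/ i = 0, i = 1 | i = 2]; last 3 first.
- by apply: smooth_on_ext s0 => // y _; rewrite !mxE.
- by apply: smooth_on_ext s11 => // y _; rewrite !mxE.
- apply: smooth_on_ext (smooth_onM Wo s0 (smooth_onM Wo s1 s11)) => // y _.
  by rewrite !mxE.
by case: i => [[|[|[|//]]]] ?; [apply: Or31|apply: Or32|apply: Or33]; apply/val_inj.
Qed.

Lemma derive_std (y v : 'rV[R]_2) : 'D_v std y =
  \row_(i < 3) [:: v 0 0; 2 * y 0 1 * v 0 1;
                  y 0 1 ^+ 3 * v 0 0 + 3 * y 0 0 * y 0 1 ^+ 2 * v 0 1]`_i.
Proof.
have dstd : differentiable std y.
  exact: (smooth_on_differentiable (smooth_std openT)).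
have dc (i : 'I_2) : is_derive y v (fun z : 'rV[R]_2 => z 0 i) (v 0 i).
  split; last exact: derive_coord.
  exact: (smooth_on_derivable (smooth_on_proj i openT)).
apply/rowP => i; rewrite (derive_row v i dstd) !mxE.
have [->|->|->] : [\/ i = 0, i = 1 | i = 2]; last 3 first.
- rewrite (_ : (fun _ => _) = (fun z : 'rV[R]_2 => z 0 0)); first exact: derive_coord.
  by apply/funext => z; rewrite !mxE.
- rewrite (_ : (fun _ => _) = (fun z : 'rV[R]_2 => z 0 1) ^+ 2).
    by have [_ ->] := is_deriveX 2 (dc 1); rewrite /GRing.scale/= expr1; ring.
  by apply/funext => z; rewrite !mxE.
- rewrite (_ : (fun _ => _) =
     (fun z : 'rV[R]_2 => z 0 0) * (fun z : 'rV[R]_2 => z 0 1) ^+ 3).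
    have [_ ->] := is_deriveM (dc 0) (is_deriveX 3 (dc 1)).
    rewrite /GRing.scale/= exprfctE/=; ring.
  by apply/funext => z; rewrite !mxE.
by case: i => [[|[|[|//]]]] ?; [apply: Or31|apply: Or32|apply: Or33]; apply/val_inj.
Qed.

Lemma derive_comp_std (F : 'rV[R]_3 -> 'rV[R]_3) (y v : 'rV[R]_2) :
  differentiable F (std y) ->
  'D_v (F \o std) y = v 0 0 *: 'D_('e_0) F (std y) +
    (2 * y 0 1 * v 0 1) *: 'D_('e_1) F (std y) +
    (y 0 1 ^+ 3 * v 0 0 + 3 * y 0 0 * y 0 1 ^+ 2 * v 0 1) *: 'D_('e_2) F (std y).
Proof.
move=> dF; rewrite derive_comp_row//; last first.
  exact: (smooth_on_differentiable (smooth_std openT)).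
have sum3 (k : 'I_3 -> R) (P : 'I_3 -> 'rV[R]_3) :
    \sum_(i < 3) k i *: P i = k 0 *: P 0 + k 1 *: P 1 + k 2 *: P 2.
  by rewrite !big_ord_recl big_ord0 addr0 addrA !ord3E.
rewrite derive_std; apply: etrans (sum3 _ (fun i => 'D_('e_i) F (std y))) _.
by rewrite !mxE.
Qed.


(** The field ph of the chart: the velocity (0, 2 v, 3 u v^2) of the standard cross
    cap is divided by v and pushed forward by Psi. *)
Definition cross_cap_dv (Psi : 'rV[R]_3 -> 'rV[R]_3) (y : 'rV[R]_2) : 'rV[R]_3 :=
  2 *: 'D_('e_1) Psi (std y) + (3 * (y 0 0 * y 0 1)) *: 'D_('e_2) Psi (std y).

(** With P_i the images of the standard basis under the differential of Psi, one has
    g_u = P_0 + v^3 P_2 and ph = 2 P_1 + 3 u v P_2, so det(g_u, ph, P_2) is twice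
    det(P_0, P_1, P_2) and does not vanish; since n spans the orthogonal of g_u and
    ph, neither det(g_u, ph, n) nor <P_2, n> vanishes.  On the axis
    ph_v = 3 u P_2, which gives [ad_cross]. *)
Lemma cross_cap_adapted_chart (W : set 'rV[R]_2) (C D : set 'rV[R]_3)
    (Phi Psi : 'rV[R]_3 -> 'rV[R]_3) (g n : 'rV[R]_2 -> 'rV[R]_3) :
  open W -> diffeo C D Phi Psi -> (forall y, W y -> D (std y)) ->
  (forall y, W y -> g y = Psi (std y)) ->
  smooth_on W g -> smooth_on W n ->
  (forall y, W y -> dot (n y) (n y) = 1) ->
  (forall y v, W y -> dot ('D_v g y) (n y) = 0) ->
  adapted_chart W g (cross_cap_dv Psi) n.
Proof.
move=> Wo dPP WD gE sg sn n1 gn.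
have [[_ _ _ sPsi] _] := dPP.
have sP i : smooth_on W ('D_('e_i) Psi \o std).
  exact: smooth_on_comp WD (smooth_on_derive _ sPsi) (smooth_std Wo).
have s0 := smooth_on_proj 0 Wo; have s1 := smooth_on_proj 1 Wo.
have s3 : smooth_on W (fun y : 'rV[R]_2 => 3 * (y 0 0 * y 0 1)).
  by apply: smooth_onM => //; [exact: smooth_on_cst|exact: smooth_onM].
have sph : smooth_on W (cross_cap_dv Psi).
  apply: (smooth_onD Wo); last exact: smooth_onZ Wo s3 (sP 2).
  exact: smooth_onZ Wo (smooth_on_cst _ _) (sP 1).
have gD y v : W y -> 'D_v g y = 'D_v (Psi \o std) y.
  move=> Wy; apply: near_eq_derive; near=> z; apply: gE.
  by near: z; exact: open_nbhs_nbhs.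
have dPsi y : W y -> differentiable Psi (std y).
  by move=> /WD; exact: smooth_on_differentiable.
have gu y : W y -> 'D_e0 g y = 'D_('e_0) Psi (std y) + y 0 1 ^+ 3 *: 'D_('e_2) Psi (std y).
  move=> Wy; rewrite (gD _ _ Wy) (derive_comp_std _ (dPsi _ Wy)) !basis_vecE/=.
  by rewrite !(mulr0, mulr1, addr0, scale1r, scale0r).
have gv y : W y -> 'D_e1 g y = y 0 1 *: cross_cap_dv Psi y.
  move=> Wy; rewrite (gD _ _ Wy) (derive_comp_std _ (dPsi _ Wy)) !basis_vecE/=.
  rewrite /cross_cap_dv.
  move: ('D_('e_1) Psi (std y)) ('D_('e_2) Psi (std y)) => a b.
  by apply/rowP => i; rewrite !mxE; ring.
(* Off the axis ph is a multiple of g_v; on it, this follows by continuity. *)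
have phn y : W y -> dot (cross_cap_dv Psi y) (n y) = 0.
  move=> Wy; have [y1|y1] := eqVneq (y 0 1) 0; last first.
    have := gn _ e1 Wy; rewrite gv// dotZl => /eqP.
    by rewrite mulf_eq0 (negPf y1) => /eqP.
  have sphn := smooth_on_dot Wo sph sn.
  apply: (@eq0_line _ _ (fun z => dot (cross_cap_dv Psi z) (n z)) y e1).
    exact: smooth_on_continuous sphn Wy.
  near=> t.
  have t0 : t != 0 by near: t; exact: nbhs_dnbhs_neq.
  have Wz : W (y + t *: e1) by near: t; apply: line_near; exact: open_nbhs_nbhs.
  have := gn _ e1 Wz; rewrite gv// dotZl add_e1E// => /eqP.
  by rewrite mulf_eq0 (negPf t0) => /eqP ->; rewrite mulr0.
have det_ne y : W y -> det3 ('D_e0 g y) (cross_cap_dv Psi y) ('D_('e_2) Psi (std y)) != 0.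
  move=> Wy; rewrite gu// /cross_cap_dv.
  have := diffeo_det3 (diffeo_sym dPP) (WD _ Wy).
  move: ('D_('e_0) Psi (std y)) ('D_('e_1) Psi (std y)) ('D_('e_2) Psi (std y)) => a b c.
  move=> abc; rewrite (_ : det3 _ _ _ = 2 * det3 a b c).
    by rewrite mulf_neq0// pnatr_eq0.
  by rewrite !det3E !mxE; ring.
have T0 y : W y -> det3 ('D_e0 g y) (cross_cap_dv Psi y) (n y) != 0.
  move=> Wy; have W0 := gram_independent (det_ne y Wy).
  have := det3_normal_gram (n y) (gn _ e0 Wy) (phn _ Wy).
  rewrite n1// mulr1; apply: contra_eq_neq => ->; rewrite mul0r eq_sym; exact: W0.
split => //; first by move=> y /gn; exact.
move=> y Wy y1 y0.
have -> : 'D_e1 (cross_cap_dv Psi) y = (3 * y 0 0) *: 'D_('e_2) Psi (std y).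
  have dc (i : 'I_2) : is_derive y e1 (fun z : 'rV[R]_2 => z 0 i) ((e1 : 'rV[R]_2) 0 i).
    split; last exact: derive_coord.
    exact: (smooth_on_derivable (smooth_on_proj i openT)).
  have flat i : 'D_e1 ('D_('e_i) Psi \o std) y = 0.
    have dP := smooth_on_differentiable (smooth_on_derive 'e_i sPsi) (WD _ Wy).
    rewrite (derive_comp_std _ dP) !basis_vecE/= y1.
    move: ('D_('e_0) _ _) ('D_('e_1) _ _) ('D_('e_2) _ _) => a b c.
    by apply/rowP => j; rewrite !mxE; ring.
  have d2 : differentiable (cst (2 : R)) y by exact: differentiable_cst.
  have dc3 := smooth_on_differentiable s3 Wy.
  have dP i := smooth_on_differentiable (sP i) Wy.
  have E3 : 'D_e1 (fun z : 'rV[R]_2 => 3 * (z 0 0 * z 0 1)) y = 3 * y 0 0.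
    have [_ E] := is_deriveM (is_derive_cst (3 : R) y e1) (is_deriveM (dc 0) (dc 1)).
    apply: etrans E _; rewrite /GRing.scale/= !basis_vecE/=.
    by rewrite !(mulr0, mulr1, addr0).
  have E1 : 'D_e1 (fun z => 2 *: 'D_('e_1) Psi (std z)) y = 0.
    apply: etrans (derive_scaled e1 d2 (dP 1)) _.
    by rewrite (flat 1) derive_cst scale0r scaler0 addr0.
  have E2 : 'D_e1 (fun z : 'rV[R]_2 => (3 * (z 0 0 * z 0 1)) *: 'D_('e_2) Psi (std z)) y =
      (3 * y 0 0) *: 'D_('e_2) Psi (std y).
    apply: etrans (derive_scaled e1 dc3 (dP 2)) _.
    by rewrite (flat 2) E3 scaler0 addr0.
  have F1 := smooth_onZ Wo (smooth_on_cst _ (2 : R)) (sP 1).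
  have F2 := smooth_onZ Wo s3 (sP 2).
  have E := deriveD (smooth_on_derivable (v := e1) F1 Wy)
    (smooth_on_derivable (v := e1) F2 Wy).
  by apply: etrans E _; apply: etrans (congr2 +%R E1 E2) _; rewrite add0r.
have E := det3_normal_gram ('D_('e_2) Psi (std y)) (gn _ e0 Wy) (phn _ Wy).
rewrite dotZl mulf_neq0//; first by rewrite mulf_neq0// pnatr_eq0.
rewrite dotC; apply/eqP => P0; move/eqP: E; rewrite P0 mulr0.
by rewrite mulf_eq0 (negPf (T0 _ Wy)) (negPf (det_ne _ Wy)).
Unshelve. all: by end_near. Qed.

Lemma exists_adapted_chart (U : set 'rV[R]_2) (f nu : 'rV[R]_2 -> 'rV[R]_3) (p : 'rV[R]_2) :
  open U -> frontal U f nu -> U p -> cuspidal_cross_cap f p ->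
  exists (A B : set 'rV[R]_2) (phi psi : 'rV[R]_2 -> 'rV[R]_2) (r : R)
    (ph : 'rV[R]_2 -> 'rV[R]_3),
    [/\ diffeo A B phi psi, A p & phi p = 0] /\
    [/\ 0 < r, ball 0 r `<=` B, forall y, ball 0 r y -> U (psi y) &
        adapted_chart (ball 0 r) (f \o psi) ph (nu \o psi)].
Proof.
move=> Uo Fr Up [A [B [phi [psi [C [D [Phi [Psi [[dpp Ap phip] [dPP Cfp Phifp]]]]]]]]]] nf.
have [[Ao Bo sphi spsi] [AB BA pk kp]] := dpp.
have [[Co Do sPhi sPsi] [CD DC Pk kP]] := dPP.
have [sf snu n1 fn] := Fr.
have B0 : B 0 by rewrite -phip; exact: AB.
have psi0 : psi 0 = p by rewrite -phip pk.
have cpsi : psi @ (0 : 'rV[R]_2) --> p.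
  by rewrite -psi0; exact: smooth_on_continuous spsi B0.
have cf : f @ p --> f p by exact: smooth_on_continuous sf Up.
have nB : \forall y \near (0 : 'rV[R]_2), B y by exact: open_nbhs_nbhs.
have nU : \forall y \near (0 : 'rV[R]_2), U (psi y).
  by apply: cpsi; exact: open_nbhs_nbhs.
have nC : \forall y \near (0 : 'rV[R]_2), C (f (psi y)).
  have nfC : nbhs p (f @^-1` C) by apply: cf; exact: open_nbhs_nbhs.
  exact: cpsi nfC.
have std0 : std 0 = 0.
  apply/rowP => i; rewrite !mxE.
  by case: i => [[|[|[|//]]]] ?; rewrite /= ?expr0n ?mul0r.
have nD : \forall y \near (0 : 'rV[R]_2), D (std y).
  have cs : std @ (0 : 'rV[R]_2) --> (0 : 'rV[R]_3).
    by rewrite -[X in _ --> X]std0; exact: smooth_on_continuous (smooth_std openT) _.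
  by apply: cs; apply: open_nbhs_nbhs; split => //; rewrite -Phifp; exact: CD.
have /nbhs_ballP[r /= r0 Hr] : \forall y \near (0 : 'rV[R]_2),
    [/\ B y, U (psi y), D (std y) & f (psi y) = Psi (std y)].
  near=> y.
  have By : B y by near: y.
  have Uy : U (psi y) by near: y.
  have Cy : C (f (psi y)) by near: y.
  have Dy : D (std y) by near: y.
  have Ey : Phi (f (psi y)) = std y by near: y.
  by split => //; rewrite -Ey Pk.
exists A, B, phi, psi, r, (cross_cap_dv Psi); split => //.
have WU y : ball 0 r y -> U (psi y) by move=> /Hr[].
have WB : ball 0 r `<=` B by move=> y /Hr[].
have Wo : open (ball (0 : 'rV[R]_2) r) by exact: ball_open.
have sW := smooth_on_sub WB spsi.
split => //; apply: (cross_cap_adapted_chart Wo dPP).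
- by move=> y /Hr[].
- by move=> y /Hr[].
- exact: smooth_on_comp WU sf sW.
- exact: smooth_on_comp WU snu sW.
- move=> y /WU Uy; have := n1 _ Uy; rewrite /enorm => E.
  by rewrite /= -[LHS]sqr_sqrtr ?dot_ge0// E expr1n.
- move=> y v Wy; rewrite (derive_compE (F := f)); first exact: fn (WU _ Wy).
  + exact: smooth_on_differentiable sW Wy.
  + exact: smooth_on_differentiable sf (WU _ Wy).
Unshelve. all: by end_near. Qed.

End CrossCap.

(** * Images of open sets under immersions of the line *)

Section OpenImage.
Set Implicit Arguments.
Unset Strict Implicit.
Context {R : realType}.

(** If the derivative at t is nonzero, c takes values on both sides of c t near t, and
    the intermediate value theorem applies. *)
Lemma open_image (c : R -> R) (S : set R) : open S -> smooth_on S c ->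
  (forall t, S t -> 'D_1 c t != 0) -> open (c @` S).
Proof.
move=> So sc c0; rewrite openE => _ [t St <-]; rewrite /interior.
have dc : derivable c t 1 by apply: (smooth_on_derivable sc St).
have cq := cvg_difference_quotient dc.
have d2 : 0 < 'D_1 c t * 'D_1 c t by rewrite -expr2 exprn_even_gt0//; exact: c0.
have cqd : 'D_1 c t * (h^-1 *: (c (t + h *: 1) - c t)) @[h --> (0 : R)^'] -->
    'D_1 c t * 'D_1 c t by apply: cvgM cq; exact: cvg_cst.
have pos : \forall h \near (0 : R)^', 0 < 'D_1 c t * (h^-1 *: (c (t + h *: 1) - c t)).
  exact: cvgr_gt cqd _ d2.
have [d d0 Hd] := dnbhs0P pos.
have /nbhs_ballP[e /= e0 He] : nbhs t S by exact: open_nbhs_nbhs.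
have [h [h0 hd he]] : exists h : R, [/\ 0 < h, h < d & h < e].
  exists (Num.min d e / 2); have m0 : 0 < Num.min d e by rewrite lt_min d0.
  have mm : Num.min d e / 2 < Num.min d e by rewrite ltr_pdivrMr// ltr_pMr// ltr1n.
  by split; [rewrite divr_gt0|apply: lt_le_trans mm _; rewrite ge_min lexx|
    apply: lt_le_trans mm _; rewrite ge_min lexx orbT].
have inS x : x \in `[t - h, t + h] -> S x.
  rewrite in_itv/= => /andP[x1 x2]; apply: He; rewrite -ball_normE/= ltr_norml.
  by apply/andP; split; lra.
have up : 0 < 'D_1 c t * (c (t + h) - c t).
  have := Hd h _ _; rewrite gt_eqF// gtr0_norm// => /(_ isT hd).
  rewrite [h *: 1]mulr1 [_ *: _]mulrC mulrA pmulr_lgt0// ?invr_gt0//.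
have down : 'D_1 c t * (c (t - h) - c t) < 0.
  have := Hd (- h) _ _; rewrite oppr_eq0 gt_eqF// normrN gtr0_norm// => /(_ isT hd).
  rewrite [- h *: 1]mulr1 [_ *: _]mulrC mulrA invrN mulrN oppr_gt0 pmulr_llt0// ?invr_gt0//.
have cc : {within `[t - h, t + h], continuous c}.
  apply: derivable_within_continuous => x /inS Sx.
  exact: (smooth_on_derivable sc Sx).
have ht : t - h <= t + h by lra.
have lo : Num.min (c (t - h)) (c (t + h)) < c t < Num.max (c (t - h)) (c (t + h)).
  rewrite gt_min lt_max; have [D|D|D] := ltgtP ('D_1 c t) 0.
  - move: up down; rewrite nmulr_rgt0// nmulr_rlt0// subr_lt0 subr_gt0 => -> ->.
    by rewrite orbT.
  - move: up down; rewrite pmulr_rgt0// pmulr_rlt0// subr_lt0 subr_gt0 => -> ->.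
    by rewrite orbT.
  - by move: up; rewrite D mul0r ltxx.
have nI := near_in_itvoo (_ : c t \in `]Num.min (c (t - h)) (c (t + h)),
   Num.max (c (t - h)) (c (t + h))[).
apply: filterS (nI _); last by rewrite in_itv.
move=> v; rewrite in_itv/= => /andP[v1 v2].
have [|x xI <-] := IVT ht cc _ (v := v); first by rewrite !ltW.
by exists x => //; exact: inS.
Qed.

End OpenImage.

(** * The second fundamental form along the singular curve *)

Section SecondFormOnAxis.
Set Implicit Arguments.
Unset Strict Implicit.
Context {R : realType}.

Section InCoordinates.
Variables (U A B : set 'rV[R]_2) (f nu ph : 'rV[R]_2 -> 'rV[R]_3)
  (phi psi : 'rV[R]_2 -> 'rV[R]_2) (W : set 'rV[R]_2).
Hypotheses (Uo : open U) (Fr : frontal U f nu) (D : diffeo A B phi psi) (WB : W `<=` B)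
  (WU : forall y, W y -> U (psi y)) (ad : adapted_chart W (f \o psi) ph (nu \o psi)).

Let g := f \o psi.
Let n := nu \o psi.

Lemma dpsi_onto y : W y -> forall v, 'd psi y ('d phi (psi y) v) = v.
Proof.
move=> /WB By v; have [_ [_ BA _ kp]] := D.
by have := diffeo_diffK v D (BA _ By); rewrite kp.
Qed.

Lemma df_psi y v : W y -> 'd f (psi y) ('d psi y v) = 'D_v g y.
Proof.
move=> Wy; rewrite (derive_f_psi Fr D WB WU)//; congr ('d f (psi y) _).
have [[_ _ _ s] _] := D.
by rewrite deriveE//; exact: (smooth_on_differentiable s (WB Wy)).
Qed.

Lemma dnu_psi y v : W y -> 'd nu (psi y) ('d psi y v) = 'D_v n y.
Proof.
move=> Wy; rewrite (derive_nu_psi Fr D WB WU)//; congr ('d nu (psi y) _).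
have [[_ _ _ s] _] := D.
by rewrite deriveE//; exact: (smooth_on_differentiable s (WB Wy)).
Qed.

Lemma derive_row2 (F : 'rV[R]_2 -> 'rV[R]_3) y v : differentiable F y ->
  'D_v F y = v 0 0 *: 'D_e0 F y + v 0 1 *: 'D_e1 F y.
Proof.
move=> dF; have K w : 'D_w F y = 'd F y w by rewrite deriveE.
apply: etrans (K v) _; apply: etrans (linear_row2E ('d F y) v) _.
by congr (_ *: _ + _ *: _); exact/esym/K.
Qed.

(** On the axis g_v = 0 and <g_u, n_v> = - v <ph_u, n> = 0, so only the coefficient
    <g_u, n_u> = - II_uu remains. *)
Lemma second_form_eq0 y : W y -> y 0 1 = 0 ->
  (forall v w, second_form f nu (psi y) v w = 0) <-> II_uu g n y = 0.
Proof.
move=> Wy y1.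
have E v w : second_form f nu (psi y) v w =
   - dot ('D_('d phi (psi y) v) g y) ('D_('d phi (psi y) w) n y).
  rewrite /second_form; congr (- dot _ _).
    apply: etrans (df_psi _ Wy); congr ('d f (psi y) _); exact/esym/dpsi_onto.
  apply: etrans (dnu_psi _ Wy); congr ('d nu (psi y) _); exact/esym/dpsi_onto.
split=> [II0|L0 v w].
  have Luu : dot ('D_e0 g y) ('D_e0 n y) = - II_uu g n y := dot_gu_nu ad Wy.
  have E0 : - dot ('D_e0 g y) ('D_e0 n y) = 0.
    apply: etrans (II0 ('d psi y e0) ('d psi y e0)); congr (- dot _ _).
      exact/esym/df_psi.
    exact/esym/dnu_psi.
  by move: E0; rewrite Luu opprK.
rewrite E; apply/eqP; rewrite oppr_eq0; apply/eqP.
move: ('d phi (psi y) v) ('d phi (psi y) w) => {E} v' w'.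
have sg := ad_g ad; have sn := ad_n ad.
have Eg := derive_row2 v' (smooth_on_differentiable sg Wy).
have En := derive_row2 w' (smooth_on_differentiable sn Wy).
apply: etrans (congr2 dot Eg En) _.
have gv : 'D_e1 g y = 0 by rewrite /g (ad_null ad Wy) y1 scale0r.
have guu := dot_gu_nu ad Wy; have guv := dot_gu_nv ad Wy.
move: guu guv; rewrite -/g -/n L0 y1 mul0r oppr0 gv scaler0 addr0.
have bilin0 (a b c : R) (x q q' : 'rV[R]_3) : dot x q = 0 -> dot x q' = 0 ->
    dot (a *: x) (b *: q + c *: q') = 0.
  by move=> xq xq'; rewrite dotZl dotDr !dotZr xq xq'; ring.
exact: bilin0.
Qed.

End InCoordinates.
End SecondFormOnAxis.

(** * The singular curvature *)

Section Curve.
Set Implicit Arguments.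
Unset Strict Implicit.
Context {R : realType}.

Lemma det3_linear2 (L : {linear 'rV[R]_2 -> 'rV[R]_3}) (a b : 'rV[R]_2) (x : 'rV[R]_3) :
  det3 (L a) (L b) x = det2 a b * det3 (L e0) (L e1) x.
Proof.
rewrite (linear_row2E L a) (linear_row2E L b); move: (L e0) (L e1) => p q.
by rewrite !det3E det2E !mxE; ring.
Qed.

Lemma sg_mul_le0 (a b N : R) : 0 <= N -> a * b <= 0 -> Num.sg a * (b / N) <= 0.
Proof.
move=> N0 ab; have [a0|a0|->] := ltgtP a 0; last by rewrite sgr0 mul0r.
  rewrite ltr0_sg// mulN1r oppr_le0 divr_ge0//.
  by move: ab; rewrite nmulr_rle0.
rewrite gtr0_sg// mul1r mulr_le0_ge0 ?invr_ge0//.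
by move: ab; rewrite pmulr_rle0.
Qed.

Section InCoordinates.
Variables (U A B : set 'rV[R]_2) (f nu ph : 'rV[R]_2 -> 'rV[R]_3)
  (phi psi : 'rV[R]_2 -> 'rV[R]_2) (W : set 'rV[R]_2).
Hypotheses (Uo : open U) (Fr : frontal U f nu) (D : diffeo A B phi psi) (WB : W `<=` B)
  (WU : forall y, W y -> U (psi y)) (ad : adapted_chart W (f \o psi) ph (nu \o psi)).

Let g := f \o psi.
Let n := nu \o psi.
Let Wo : open W := ad_open ad.

Lemma smooth_area_density : smooth_on U (area_density f nu).
Proof.
have [sf snu _ _] := Fr.
have E q : U q -> det3 ('D_e0 f q) ('D_e1 f q) (nu q) = area_density f nu q.
  move=> Uq; have df := smooth_on_differentiable sf Uq.
  rewrite /area_density; congr det3; exact: deriveE.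
apply: smooth_on_ext Uo E _.
by apply: smooth_on_det3 => //; exact: smooth_on_derive.
Qed.

Let P y := 'D_e0 psi y.
Let Q y := 'D_e1 psi y.

(** The area density in the chart is det(g_u, g_v, n) up to the Jacobian of psi. *)
Lemma area_density_coord y : W y ->
  area_density f nu (psi y) * det2 (P y) (Q y) = y 0 1 * frame_det g ph n y.
Proof.
move=> Wy; rewrite mulrC /area_density -det3_linear2.
have -> : y 0 1 * frame_det g ph n y = det3 ('D_e0 g y) ('D_e1 g y) (n y).
  have gv : 'D_e1 g y = y 0 1 *: ph y := ad_null ad Wy.
  by rewrite gv /frame_det !det3E !mxE; ring.
by congr det3; exact/esym/(derive_f_psi Fr D WB WU).
Qed.

(** Differentiating [area_density_coord] in v at v = 0, where the area density itself
    vanishes. *)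
Lemma derive_area_density y : W y -> y 0 1 = 0 ->
  'd (area_density f nu) (psi y) (Q y) * det2 (P y) (Q y) = frame_det g ph n y.
Proof.
move=> Wy y1; have [[_ _ _ spsi] _] := D.
have sW := smooth_on_sub WB spsi.
have sl := smooth_area_density.
have dl := smooth_on_differentiable sl (WU Wy).
have dp := smooth_on_differentiable sW Wy.
pose l := area_density f nu \o psi.
pose d y := det2 (P y) (Q y).
have dl' : differentiable l y by exact: differentiable_comp.
have sd : smooth_on W d by apply: smooth_on_det2 => //; exact: smooth_on_derive.
have dd := smooth_on_differentiable sd Wy.
have dT := smooth_on_differentiable (smooth_frame_det ad) Wy.
have d1 := smooth_on_differentiable (smooth_on_proj 1 Wo) Wy.
have Q0 : d y != 0 := det2_psi D WB Wy.
have l0 : l y = 0.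
  have /eqP := area_density_coord Wy; rewrite y1 mul0r mulf_eq0 (negPf Q0) orbF => /eqP.
  exact.
have E1 : 'D_e1 (l * d) y = l y *: 'D_e1 d y + d y *: 'D_e1 l y.
  exact: deriveM (diff_derivable dl') (diff_derivable dd).
have E2 : 'D_e1 ((fun z : 'rV[R]_2 => z 0 1) * frame_det g ph n) y =
    y 0 1 *: 'D_e1 (frame_det g ph n) y +
    frame_det g ph n y *: 'D_e1 (fun z : 'rV[R]_2 => z 0 1) y.
  exact: deriveM (diff_derivable d1) (diff_derivable dT).
have E3 : 'D_e1 (l * d) y = 'D_e1 ((fun z : 'rV[R]_2 => z 0 1) * frame_det g ph n) y.
  apply: near_eq_derive; near=> z; apply: area_density_coord.
  by near: z; exact: open_nbhs_nbhs.
have E4 : 'D_e1 l y = 'd (area_density f nu) (psi y) (Q y) by exact: derive_compE.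
have := etrans (esym E1) (etrans E3 E2).
rewrite l0 y1 !scale0r !add0r derive_coord basis_vecE/= E4 => E.
by rewrite mulrC; apply: etrans E _; rewrite [_ *: _]mulr1.
Unshelve. all: by end_near. Qed.

Lemma null_vector y v : W y -> y 0 1 = 0 -> 'd f (psi y) v = 0 ->
  exists k : R, v = k *: Q y.
Proof.
move=> Wy y1 fv; pose w := 'd phi (psi y) v.
have Ev : 'd psi y w = v := dpsi_onto D WB Wy v.
have dg := smooth_on_differentiable (ad_g ad) Wy.
have gw : 'D_w g y = 0.
  apply: etrans (esym (df_psi Fr D WB WU w Wy)) _.
  by apply: etrans fv; congr ('d f (psi y) _).
have gv : 'D_e1 g y = 0 by rewrite /g (ad_null ad Wy) y1 scale0r.
have gu0 : 'D_e0 g y != 0.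
  have : frame_det g ph n y != 0 := ad_indep ad Wy.
  apply: contraNneq => gu; rewrite /frame_det gu; apply/eqP.
  by rewrite det3E !mxE; ring.
have := etrans (esym (derive_row2 w dg)) gw.
rewrite -/g gv scaler0 addr0 => /eqP; rewrite scaler_eq0 (negPf gu0) orbF => /eqP w0.
exists (w 0 1); rewrite -Ev.
have [[_ _ _ spsi] _] := D.
have dp := smooth_on_differentiable spsi (WB Wy).
apply: etrans (linear_row2E ('d psi y) w) _; rewrite w0 scale0r add0r.
by congr (_ *: _); exact/esym/deriveE.
Qed.

Section Along.
Variables (S : set R) (gamma : R -> 'rV[R]_2).
Hypotheses (So : open S) (sgam : smooth_on S gamma)
  (gA : forall t, S t -> A (gamma t)) (gW : forall t, S t -> W (phi (gamma t)))
  (gsing : forall t, S t -> singular_point f (gamma t))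
  (gamma' : forall t, S t -> derive1 gamma t != 0).

Let Y t := phi (gamma t).
Let c t := Y t 0 0.

Lemma chart_curveK t : S t -> psi (Y t) = gamma t.
Proof. by move=> /gA Ag; have [_ [_ _ pk _]] := D; exact: pk. Qed.

Lemma chart_curve_axis t : S t -> Y t 0 1 = 0.
Proof.
move=> St; apply: (singular_coord Fr D WB WU ad (gW St)).
by rewrite -/(Y t) chart_curveK//; exact: gsing.
Qed.

Lemma chart_curveE t : S t -> Y t = c t *: e0.
Proof. by move=> St; rewrite [LHS]row2E chart_curve_axis// scale0r addr0. Qed.

Lemma smooth_chart_curve : smooth_on S Y.
Proof. by have [[_ _ sphi _] _] := D; exact: smooth_on_comp gA sphi sgam. Qed.

Lemma smooth_chart_param : smooth_on S c.
Proof. exact: smooth_on_coord smooth_chart_curve. Qed.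

Lemma derive_chart_curve t : S t -> 'D_1 Y t = 'D_1 c t *: e0.
Proof.
move=> St; have dY := smooth_on_differentiable smooth_chart_curve St.
have E0 : ('D_1 Y t) 0 0 = 'D_1 c t := derive_row (1 : R) 0 dY.
have E1 : ('D_1 Y t) 0 1 = 0.
  apply: etrans (derive_row (1 : R) 1 dY) _.
  apply: etrans (_ : 'D_1 (cst (0 : R)) t = 0); last exact: derive_cst.
  apply: near_eq_derive; near=> s; apply: chart_curve_axis.
  by near: s; exact: open_nbhs_nbhs.
by rewrite [LHS]row2E E0 E1 scale0r addr0.
Unshelve. all: by end_near. Qed.

Lemma derive_gamma t : S t -> derive1 gamma t = 'D_1 c t *: P (Y t).
Proof.
move=> St; have [[_ _ _ spsi] _] := D.
have dY := smooth_on_differentiable smooth_chart_curve St.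
have dp := smooth_on_differentiable spsi (WB (gW St)).
rewrite derive1E.
have -> : 'D_1 gamma t = 'D_1 (psi \o Y) t.
  apply: near_eq_derive; near=> s; apply/esym/chart_curveK.
  by near: s; exact: open_nbhs_nbhs.
apply: etrans (derive_compE (1 : R) dY dp) _; rewrite derive_chart_curve// linearZ/=.
by congr (_ *: _); exact/esym/deriveE.
Unshelve. all: by end_near. Qed.

(** The curve moves along the axis, so its speed is carried by the abscissa. *)
Lemma derive_chart_param_neq0 t : S t -> 'D_1 c t != 0.
Proof.
by move=> St; apply: contraNneq (gamma' St) => c0; rewrite derive_gamma// c0 scale0r.
Qed.

Lemma derive_hgamma t : S t -> derive1 (f \o gamma) t = 'D_1 c t *: 'D_e0 g (Y t).
Proof.
move=> St.
have dY := smooth_on_differentiable smooth_chart_curve St.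
have dg := smooth_on_differentiable (ad_g ad) (gW St).
rewrite derive1E.
have -> : 'D_1 (f \o gamma) t = 'D_1 (g \o Y) t.
  apply: near_eq_derive; near=> s; rewrite /g /=; congr f; apply/esym/chart_curveK.
  by near: s; exact: open_nbhs_nbhs.
apply: etrans (derive_compE (1 : R) dY dg) _; rewrite derive_chart_curve// linearZ/=.
by congr (_ *: _); exact/esym/deriveE.
Unshelve. all: by end_near. Qed.

Lemma derive2_hgamma t : S t -> derive1 (derive1 (f \o gamma)) t =
  'D_1 ('D_1 c) t *: 'D_e0 g (Y t) + 'D_1 c t ^+ 2 *: 'D_e0 ('D_e0 g) (Y t).
Proof.
move=> St.
have dY := smooth_on_differentiable smooth_chart_curve St.
have sgu : smooth_on W ('D_e0 g) := smooth_on_derive e0 (ad_g ad).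
have dgu := smooth_on_differentiable sgu (gW St).
have dc := smooth_on_differentiable (smooth_on_derive (1 : R) smooth_chart_param) St.
have dgY := smooth_on_differentiable (smooth_on_comp So gW sgu smooth_chart_curve) St.
rewrite derive1E.
have -> : 'D_1 (derive1 (f \o gamma)) t = 'D_1 (fun s => 'D_1 c s *: ('D_e0 g \o Y) s) t.
  apply: near_eq_derive; near=> s; apply: derive_hgamma.
  by near: s; exact: open_nbhs_nbhs.
have E1 := derive_scaled (1 : R) dc dgY.
have E2 : 'D_1 ('D_e0 g \o Y) t = 'D_1 c t *: 'D_e0 ('D_e0 g) (Y t).
  apply: etrans (derive_compE (1 : R) dY dgu) _; rewrite derive_chart_curve// linearZ/=.
  by congr (_ *: _); exact/esym/deriveE.
by apply: etrans E1 _; rewrite E2 scalerA -expr2.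
Unshelve. all: by end_near. Qed.

(** Write gamma' = c' psi_u and xi = k psi_v.  With D = det(psi_u, psi_v) the
    derivative of the area density along xi is k T / D, and
    det(hgamma', hgamma'', n) = c'^3 det(g_u, g_uu, n).  Their product is
    (c' k D) (c' / D)^2 times [curvature_sign], and c' k D = det(gamma', xi) > 0. *)
Lemma singular_curvature_le0 t xi : S t -> 'd f (gamma t) (xi t) = 0 ->
  0 < det2 (derive1 gamma t) (xi t) -> curvature_sign g ph n (Y t) <= 0 ->
  singular_curvature f nu gamma xi t <= 0.
Proof.
move=> St fxi pos S0; have Wy := gW St; have y1 := chart_curve_axis St.
have gE := chart_curveK St.
have fxi' : 'd f (psi (Y t)) (xi t) = 0 by rewrite gE.
have [k xiE] := null_vector Wy y1 fxi'.
have DA := derive_area_density Wy y1.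
rewrite /singular_curvature -gE -/(Y t).
have dN : 'd (area_density f nu) (psi (Y t)) (xi t) =
    k * 'd (area_density f nu) (psi (Y t)) (Q (Y t)).
  by rewrite xiE linearZ.
rewrite dN derive2_hgamma// derive_hgamma// -[nu (psi (Y t))]/(n (Y t)).
apply: sg_mul_le0; first by rewrite exprn_ge0// /enorm sqrtr_ge0.
have D0 : det2 (P (Y t)) (Q (Y t)) != 0 := det2_psi D WB Wy.
move: pos; rewrite xiE derive_gamma//.
move: S0; rewrite /curvature_sign -[frame_det g ph n (Y t)]DA -/(n (Y t)).
move: D0 ('d (area_density f nu) (psi (Y t)) (Q (Y t))).
move: (P (Y t)) (Q (Y t)) ('D_1 c t) ('D_1 ('D_1 c) t) (n (Y t)).
move: ('D_e0 g (Y t)) ('D_e0 ('D_e0 g) (Y t)) => gu guu p q c1 c2 m pq0 dl S0 pos.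
have pos' : 0 < c1 * k * det2 p q.
  by move: pos; rewrite !det2E !mxE; apply: eq_ind; congr (0 < _); ring.
rewrite (_ : _ * _ = (c1 * k * det2 p q) * (c1 / det2 p q) ^+ 2 *
   (dl * det2 p q * det3 gu guu m)).
  by rewrite mulr_ge0_le0// mulr_ge0 ?sqr_ge0// ltW.
rewrite !det3E !mxE; field; exact: pq0.
Qed.

End Along.
End InCoordinates.
End Curve.

(** * Bounded and nonnegative curvature at a cuspidal cross cap *)

Theorem proposition1p12 (R : realType) (U : set 'rV[R]_2)
    (f nu : 'rV[R]_2 -> 'rV[R]_3) (p : 'rV[R]_2)
    (gamma : R -> 'rV[R]_2) (eps0 : R)
    (U_open : open U) (U_connected : connected U)
    (f_frontal : frontal U f nu)
    (Up : U p) (p_ccc : cuspidal_cross_cap f p)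
    (eps0_gt0 : 0 < eps0) (gamma_sing : singular_curve U f nu gamma eps0)
    (gamma0 : gamma 0 = p) :
  exists2 eps1 : R, 0 < eps1 <= eps0 &
  forall eps : R, 0 < eps < eps1 ->
  let J := gamma @` (`]-eps, eps[%classic) in
  ((exists V : set 'rV[R]_2,
      [/\ open V, J `<=` V, V `<=` U & curvature_bounded_on f nu V]) <->
   second_form_vanishes_on f nu J) /\
  (forall V : set 'rV[R]_2, open V -> V p -> V `<=` U ->
   (forall q, (V `\` J) q -> regular_point f q ->
      0 <= gaussian_curvature f nu q) ->
   forall xi : R -> 'rV[R]_2, positive_null_field f gamma xi eps ->
   forall t : R, `]-eps, eps[%classic t -> V (gamma t) ->
   singular_curvature f nu gamma xi t <= 0).
Proof.
have [A [B [phi [psi [r [ph [[D Ap phip] [r0 WB WU ad]]]]]]]] :=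
  exists_adapted_chart U_open f_frontal Up p_ccc.
have [sgam gam] := gamma_sing.
have [[Ao Bo sphi spsi] [AB BA pk kp]] := D.
pose W : set 'rV[R]_2 := ball 0 r.
have Wo : open W := ad_open ad.
have r20 : 0 < r / 2 by rewrite divr_gt0.
have rr : r / 2 < r by rewrite ltr_pdivrMr// ltr_pMr// ltr1n.
have ballE (d : R) (y : 'rV[R]_2) : ball 0 d y = (`|y| < d) :> Prop.
  by rewrite -ball_normE/= sub0r normrN.
(* The radius r / 2 keeps the curve inside a compact subset of the chart, where
   [bounded_of_flat] gives a uniform bound. *)
have [e1' e10 He] : exists2 e : R, 0 < e & forall t, `|t| < e ->
    A (gamma t) /\ `|phi (gamma t)| < r / 2.
  have S0 : `]- eps0, eps0[%classic (0 : R) by rewrite /= in_itv/= oppr_lt0 eps0_gt0.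
  have cg : gamma @ (0 : R) --> p.
    by rewrite -gamma0; exact: smooth_on_continuous sgam S0.
  have cp : phi @ p --> (0 : 'rV[R]_2).
    by rewrite -phip; exact: smooth_on_continuous sphi Ap.
  have nA : nbhs p A by exact: open_nbhs_nbhs.
  have nb : nbhs p (phi @^-1` ball 0 (r / 2)).
    by apply: cp; exact: nbhsx_ballx.
  have ng : nbhs (0 : R) (gamma @^-1` (A `&` phi @^-1` ball 0 (r / 2))).
    have nAb : nbhs p (A `&` phi @^-1` ball 0 (r / 2)) by exact: filterI.
    by move: (cg _ nAb); rewrite nbhs_filterE fmapE.
  have /nbhs_ballP[e /= e0' H] := ng.
  exists e => // t te; have [|? ?] := H t; last by rewrite -ballE.
  by rewrite -ball_normE/= sub0r normrN.
exists (Num.min e1' eps0); first by rewrite lt_min e10 eps0_gt0/= ge_min lexx orbT.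
move=> eps /andP[eps_gt0]; rewrite lt_min => /andP[ee1 ee0] J.
pose S : set R := `]- eps, eps[%classic.
have So : open S by exact: interval_open.
have SE t : S t -> `|t| < eps by rewrite /S/= in_itv/= -ltr_norml.
have S0 t : S t -> `]- eps0, eps0[%classic t.
  by move=> /SE te; rewrite /= in_itv/= -ltr_norml (lt_trans te).
have gA t : S t -> A (gamma t) by move=> /SE te; case: (He t (lt_trans te ee1)).
have gr t : S t -> `|phi (gamma t)| < r / 2.
  by move=> /SE te; case: (He t (lt_trans te ee1)).
have gW t : S t -> W (phi (gamma t)).
  by move=> /gr h; rewrite /W ballE (lt_trans h).
have gsing t : S t -> singular_point f (gamma t) by move=> /S0/gam[_ _ []].
have gamma' t : S t -> derive1 gamma t != 0 by move=> /S0/gam[].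
have sgS : smooth_on S gamma by apply: smooth_on_sub sgam.
have yE := chart_curveK D gA.
have y1 := chart_curve_axis f_frontal D WB WU ad gA gW gsing.
have chart (V : set 'rV[R]_2) t : open V -> S t -> V (gamma t) ->
    exists O : set 'rV[R]_2, [/\ open O, O `<=` W, O `<=` psi @^-1` V & O (phi (gamma t))].
  move=> Vo St Vg; exists (W `&` psi @^-1` V)^°; split.
  - exact: open_interior.
  - by move=> y /interior_subset[].
  - by move=> y /interior_subset[].
  - apply: filterI; first exact: open_nbhs_nbhs (conj Wo (gW _ St)).
    have cpsi : psi @ phi (gamma t) --> psi (phi (gamma t)).
      exact: smooth_on_continuous spsi (WB _ (gW _ St)).
    by apply: cpsi; rewrite yE//; exact: open_nbhs_nbhs.
have KE y : W y -> 
    gaussian_curvature f nu (psi y) = chart_curvature (f \o psi) ph (nu \o psi) y.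
  exact: (curvature_coord f_frontal D WB WU ad).
have regular y : W y -> y 0 1 != 0 -> regular_point f (psi y).
  by move=> Wy y10 /(singular_coord f_frontal D WB WU ad Wy) y10'; case/eqP: y10.
have flatE y : W y -> y 0 1 = 0 ->
  (forall v w, second_form f nu (psi y) v w = 0) <-> II_uu (f \o psi) (nu \o psi) y = 0.
  exact: (second_form_eq0 f_frontal D WB WU ad).
split; first split.
- move=> [V [Vo JV VU [M KM]]] q [t St <-].
  have [N [No NW NV Nt]] := chart V t Vo St (JV _ (imageP gamma St)).
  rewrite -(yE _ St); apply/(flatE _ (gW _ St) (y1 _ St)).
  apply: (flat_of_bounded ad (O := N) (M0 := M)) => //; last exact: y1.
  move=> y Oy y10; rewrite -KE; last exact: NW.
  by apply: KM; [exact: NV|apply: regular => //; exact: NW].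
- move=> IIJ.
  pose c t := phi (gamma t) 0 0.
  have co : open (c @` S).
    apply: open_image => //; first exact: (smooth_chart_param D So sgS gA).
    move=> t St.
    exact: (derive_chart_param_neq0 f_frontal D WB WU ad So sgS gA gW gsing gamma' St).
  have flat u : (c @` S) u -> `|u| < r ->
      II_uu (f \o psi) (nu \o psi) (u *: basis_vec 0) = 0.
    move=> [t St <-] _.
    have <- := chart_curveE f_frontal D WB WU ad gA gW gsing St.
    apply/(flatE _ (gW _ St) (y1 _ St)) => v w.
    by rewrite yE//; apply: IIJ; exists t.
  have [M KM] := bounded_of_flat rr ad flat.
  (* K must be bounded only over abscissas reached by the curve, where II_uu = 0. *)
  pose O : set 'rV[R]_2 := ball 0 (r / 2) `&` (fun y : 'rV[R]_2 => (c @` S) (y 0 0)).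
  have Oo : open O.
    apply: openI; first exact: ball_open.
    by apply: open_comp co => y _; exact: coord_continuous.
  exists (A `&` phi @^-1` O); split.
  - rewrite openE => q [Aq Oq]; apply: filterI; first exact: open_nbhs_nbhs.
    have cp := smooth_on_continuous sphi Aq.
    by apply: cp; exact: open_nbhs_nbhs.
  - move=> _ [t St <-]; split; first exact: gA.
    by split; [rewrite ballE; exact: gr|exists t].
  - move=> q [Aq [Oq _]]; rewrite -(pk _ Aq); apply: WU.
    by move: Oq; rewrite !ballE => /lt_trans; apply.
  - exists `|M| => q [Aq [Oq Iq]] _.
    move: Oq; rewrite ballE => Oq; have Wq : W (phi q) by rewrite /W ballE (lt_trans Oq).
    rewrite -(pk _ Aq) KE//; have [q1|q1] := eqVneq (phi q 0 1) 0.
      by rewrite chart_curvature_singular// normr0.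
    by apply: le_trans (ler_norm M); apply: KM => //; exact: ltW.
- move=> V Vo Vp VU KV xi [_ xiS] t St Vt.
  have [N [No NW NV Nt]] := chart V t Vo St Vt.
  have [_ fxi pos] := xiS t St.
  apply: (singular_curvature_le0 U_open f_frontal D WB WU ad So sgS gA gW gsing St fxi pos).
  apply: (sign_of_nonneg ad No NW _ Nt (y1 _ St)) => y Oy y10.
  rewrite -KE; last exact: NW.
  apply: KV; last by apply: regular => //; exact: NW.
  split; first exact: NV.
  move=> [s Ss gs]; case/eqP: y10.
  have By := WB _ (NW _ Oy).
  by rewrite -(kp _ By) -gs y1.
Qed.
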